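(* Let $\mathfrak g$ be a complex simple Lie algebra of type $A_n$ ($n\ge1$) or $D_4$. Then: (1) for every flag minor $x\in\mathbb C[\mathsf N]$ (i.e. every cluster variable of some standard seed $\mathcal S^{\mathbf i}$, $\mathbf i$ a reduced expression of $w_0$), one has $$\overline D(x)=\frac{1}{\prod_{\beta\in\Phi_+}\beta^{n_\beta(x)}}$$ for some nonnegative integers $n_\beta(x)$, $\beta\in\Phi_+$; (2) for every reduced expression $\mathbf i=(i_1,\dots,i_N)$ of $w_0$, with standard seed $\mathcal S^{\mathbf i}=((x_1,\dots,x_N),Q^{\mathbf i})$, the polynomials $P_j:=(\overline D(x_j))^{-1}$ satisfy, for every $1\le j\le N$, $$P_jP_{j_-}=\beta_j\prod_{\substack{l<j<l_+\\ i_l\cdot i_j=-1}}P_l,$$ with the convention $P_0:=1$.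
   Context: $\mathfrak g$ is a finite-dimensional complex simple Lie algebra of simply-laced type with Dynkin vertex set $I=\{1,\dots,n\}$; $i\cdot j$ denotes the Cartan matrix entry ($i\cdot i=2$, $i\cdot j=-1$ if $i,j$ are adjacent, $0$ otherwise). $W$ is the Weyl group with simple reflections $s_i$, $w_0$ its longest element, $N:=\ell(w_0)$, $\Phi_+$ the positive roots, $\omega_i$ the fundamental weights. $\mathsf N$ is the unipotent radical of a Borel subgroup of the simply connected group $G$ with Lie algebra $\mathfrak g$, $\mathfrak n=\mathrm{Lie}(\mathsf N)$ with Chevalley generators $e_i$; $\mathbb C[\mathsf N]$ is identified with the graded dual of $U(\mathfrak n)$ via a pairing $(\cdot,\cdot)$. Let $\alpha_1,\dots,\alpha_n$ be algebraically independent indeterminates; a positive root $\beta=\sum a_i\alpha_i$ is viewed as the linear form $\sum a_i\alpha_i$. For a word $\mathbf j=(j_1,\dots,j_r)$ in $I$ put $e_{\mathbf j}=e_{j_1}\cdots e_{j_r}$ and $\overline D_{\mathbf j}=\big(\alpha_{j_1}(\alpha_{j_1}+\alpha_{j_2})\cdots(\alpha_{j_1}+\dots+\alpha_{j_r})\big)^{-1}$. The Baumann–Kamnitzer–Knutson algebra morphism $\overline D:\mathbb C[\mathsf N]\to\mathbb C(\alpha_1,\dots,\alpha_n)$ is $\overline D(f)=\sum_{\mathbf j}\overline D_{\mathbf j}(f,e_{\mathbf j})$ (finite sum). For a reduced expression $\mathbf i=(i_1,\dots,i_N)$ of $w_0$: $\beta_j:=s_{i_1}\cdots s_{i_{j-1}}(\alpha_{i_j})$;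 $j_-:=\max(\{l<j: i_l=i_j\}\cup\{0\})$, $j_+:=\min(\{l>j:i_l=i_j\}\cup\{N+1\})$; the standard seed $\mathcal S^{\mathbf i}$ of Geiss–Leclerc–Schröer has cluster variables $x_j=D(s_{i_1}\cdots s_{i_j}\omega_{i_j},\omega_{i_j})$, $1\le j\le N$, where $D(u\lambda,v\lambda)$ denotes the unipotent minor (restriction to $\mathsf N$ of the matrix coefficient between extremal weight vectors of weights $u\lambda$ and $v\lambda$ in the irreducible representation of highest weight $\lambda$). These are the flag minors. *)

(* Defs.v *)
From mathcomp Require Import all_boot all_algebra fraction.
From mathcomp Require Import mpoly algC.

Set Implicit Arguments.
Unset Strict Implicit.
Unset Printing Implicit Defensive.

Import GRing.Theory.
Local Open Scope ring_scope.

Definition cartan_A (i j : nat) : int :=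
  if i == j then 2 else if (i == j.+1) || (j == i.+1) then -1 else 0.

Definition cartan_D4 (i j : nat) : int :=
  if i == j then 2 else if (i == 1%N) || (j == 1%N) then -1 else 0.

Definition typeA_or_D4 (r : nat) (C : 'I_r.+1 -> 'I_r.+1 -> int) : Prop :=
  (forall i j : 'I_r.+1, C i j = cartan_A i j) \/
  (r = 3%N /\ forall i j : 'I_r.+1, C i j = cartan_D4 i j).

Section LieData.
Variable r : nat.
Local Notation I := 'I_r.+1.
(* symmetric (simply-laced) Cartan matrix, C i j = i . j *)
Variable C : I -> I -> int.

(* Weights in the basis of fundamental weights: mu = sum_k mu k * omega_k,  *)
(* so that <mu, alpha_i^vee> = mu i.  alpha_i = sum_k (i.k) omega_k.         *)
Definition weight := {ffun I -> int}.
Definition omega (i : I) : weight := [ffun k => ((k == i) : nat)%:Z].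

Definition srefl_w (i : I) (mu : weight) : weight :=
  [ffun k => mu k - mu i * C i k].
Definition wact (w : seq I) (mu : weight) : weight := foldr srefl_w mu w.

(* Roots (elements of the root lattice) in the basis of simple roots.       *)
Definition rootv := {ffun I -> int}.
Definition simple_root (i : I) : rootv := [ffun k => ((k == i) : nat)%:Z].
(* s_i b = b - <b, alpha_i^vee> alpha_i, with <b,alpha_i^vee> = sum_q b_q (q.i) *)
Definition srefl_r (i : I) (b : rootv) : rootv :=
  [ffun k => if k == i then b i - \sum_(q : I) b q * C q i else b k].
Definition ract (w : seq I) (b : rootv) : rootv := foldr srefl_r b w.

Definition is_pos_root (b : rootv) : Prop :=
  (exists (w : seq I) (i : I), b = ract w (simple_root i)) /\
  (forall k, 0 <= b k).

(* Two words represent the same Weyl group element (W acts faithfully on    *)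
(* the weight lattice).                                                     *)
Definition wequiv (u v : seq I) : Prop := forall mu, wact u mu = wact v mu.

Definition is_red_w0 (w : seq I) : Prop :=
  (forall v, wequiv v w -> (size w <= size v)%N) /\
  (forall u, exists v, wequiv v u /\ (size v <= size w)%N).

(* Shapovalov form on the irreducible module L(lam):                        *)
(*   shap lam a fs = ( f_{a_1}...f_{a_p} v_lam , f_{fs_1}...f_{fs_m} v_lam ) *)
(*                 = < v_lam^*, e_{a_p} ... e_{a_1} f_{fs_1}...f_{fs_m} v_lam >*)
(* computed by moving e_{a_1} to the right using [e_i,f_k] = delta_ik h_i,  *)
(* e_i v_lam = 0 and h_i acting on weight lam - sum_{q in s} alpha_q by      *)
(* lam_i - sum_{q in s} (q.i).  (The highest-weight coefficient is the same  *)
(* in the Verma module and in L(lam).)                                       *)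
Fixpoint shap (lam : weight) (a fs : seq I) {struct a} : int :=
  match a with
  | [::] => if fs is [::] then 1 else 0
  | i :: a' =>
      let fix go (p s : seq I) : int :=
        match s with
        | [::] => 0
        | k :: s' =>
            (if k == i then (lam i - \sum_(q <- s') C q i) * shap lam a' (p ++ s')
             else 0) + go (rcons p k) s'
        end in
      go [::] fs
  end.

(* Extremal weight vector v_{u lam} = f_{u_1}^{(a_1)} ... f_{u_m}^{(a_m)} v_lam *)
(* with a_k = < s_{u_{k+1}}...s_{u_m} lam, alpha_{u_k}^vee >.                  *)
(* fdata u lam = (f-word, product of the a_k!, s_{u_1}..s_{u_m} lam).          *)
Fixpoint fdata (u : seq I) (lam : weight) : seq I * nat * weight :=
  match u with
  | [::] => ([::], 1%N, lam)
  | i :: u' =>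
      let: (fs, d, mu) := fdata u' lam in
      let a := `|mu i|%N in
      (nseq a i ++ fs, (a`! * d)%N, srefl_w i mu)
  end.

(* The unipotent minor D(u lam, lam) in C[N], given by its pairing with the *)
(* monomials e_w = e_{w_1}...e_{w_p} of U(n):                                *)
(*   (D(u lam, lam), e_w) = ( f_{w_1}...f_{w_p} v_lam , v_{u lam} ).         *)
Definition minor_pair (u : seq I) (lam : weight) (w : seq I) : algC :=
  ((shap lam w (fdata u lam).1.1)%:~R) / (((fdata u lam).1.2)%:R).

(* degree (height of lam - u lam): only words of this length pair nontrivially *)
Definition minor_deg (u : seq I) (lam : weight) : nat := size (fdata u lam).1.1.

Definition ratfun := {fraction {mpoly algC[r.+1]}}.

Definition alpha (i : I) : ratfun := tofrac ('X_i : {mpoly algC[r.+1]}).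
Definition constK (c : algC) : ratfun := tofrac (c%:MP : {mpoly algC[r.+1]}).

Definition lin (b : rootv) : ratfun := \sum_(i : I) (b i)%:~R * alpha i.

Definition Dword (w : seq I) : ratfun :=
  (\prod_(k < size w) (\sum_(x <- take k.+1 w) alpha x))^-1.

(* Dbar of a homogeneous element f of degree h of C[N] (given through its   *)
(* pairing with the words e_w): sum over all words of length h.             *)
Definition Dbar (f : seq I -> algC) (h : nat) : ratfun :=
  \sum_(w : h.-tuple I) Dword w * constK (f w).

(* Standard seed of a word w = (i_1,...,i_N); positions are 1-based.        *)
Definition letter (w : seq I) (j : nat) : I := nth ord0 w j.-1.

Definition flag_minor (w : seq I) (j : nat) : seq I -> algC :=
  minor_pair (take j w) (omega (letter w j)).

Definition Dbar_flag (w : seq I) (j : nat) : ratfun :=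
  Dbar (flag_minor w j) (minor_deg (take j w) (omega (letter w j))).

Definition Ppoly (w : seq I) (j : nat) : ratfun :=
  if j == 0%N then 1 else (Dbar_flag w j)^-1.

Definition beta (w : seq I) (j : nat) : rootv :=
  ract (take j.-1 w) (simple_root (letter w j)).

Definition jminus (w : seq I) (j : nat) : nat :=
  \max_(1 <= l < j | letter w l == letter w j) l.

(* j_+ = min({l > j : i_l = i_j} u {N+1}) *)
Definition jplus (w : seq I) (j : nat) : nat :=
  (j + (find (pred1 (letter w j)) (drop j w)).+1)%N.

End LieData.

(* Main.v *)
Require Import Defs.
From mathcomp Require Import all_boot all_order all_algebra fraction.
From mathcomp Require Import mpoly algC.
From mathcomp Require Import ring zify.
From HB Require Import structures.
From Stdlib Require Import ClassicalEpsilon FunctionalExtensionality.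

(**
  The argument works in every simply-laced type and yields the closed formula
    1 / Dbar(D(u lam, lam)) = prod_k beta_k ^ <lam, - u^-1 beta_k^vee>,
  the product running over the inversions [beta_k] of [u].  Exponents are
  additive in [lam], which gives (2), and nonnegative for [lam] dominant, which
  gives (1).

  To prove the formula, put V = functions on words in the letters [I]: an
  element of a highest weight module becomes the function
  b |-> <v_lam^*, e_b x>, so that [e_i] removes a letter, [f_k] is determined by
  [e_i f_k = f_k e_i + delta_ik h_k], and the Serre relations hold on all of V.
  For a generic point [h] (the values of the simple roots), the series
  [Gser h v = sum_w Dbar_w e_w v] is the unique finitely supported eigenvector
  of [Xop h = h + sum_i e_i] with leading term [v], and Dbar is its value at the
  empty word.  If [e_i v = 0] and [v] has [h_i]-weight [m >= 0], then
  [exp (h_i f_i)] maps [Gser (s_i h) v] to a multiple of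
  [Gser h (f_i^(m) v)] without changing the value at the empty word: passing
  from [v] to [f_i^(m) v] divides the value by [h_i^m] and replaces [h] by
  [s_i h].

  That [e_i] kills the extremal vector of weight [u lam] when
  [u^-1 alpha_i > 0] is the W-invariance of the set of weights of an integrable
  module (sl_2 theory).
*)

Set Implicit Arguments.
Unset Strict Implicit.
Unset Printing Implicit Defensive.

Import Order.TTheory GRing.Theory Num.Theory.
Local Open Scope ring_scope.

(** * Vector space structure on functions *)

(* MathComp's module theory needs a [choiceType], which classical choice
   provides for all functions [T -> K]. *)
Section FunctionSpace.
Variables (T : Type) (K : fieldType).

Definition fspace : Type := T -> K.

Definition fspace_eqb (x y : fspace) : bool :=
  if excluded_middle_informative (x = y) then true else false.

Lemma fspace_eqP : Equality.axiom fspace_eqb.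
Proof.
by move=> x y; rewrite /fspace_eqb; case: excluded_middle_informative => h;
  constructor.
Qed.

HB.instance Definition _ := hasDecEq.Build fspace fspace_eqP.

Definition fspace_find (P : pred fspace) (n : nat) : option fspace :=
  match excluded_middle_informative (exists x, P x) with
  | left h => Some (sval (constructive_indefinite_description _ h))
  | right _ => None
  end.

Lemma fspace_find_correct P n x : fspace_find P n = Some x -> P x.
Proof.
rewrite /fspace_find; case: excluded_middle_informative => // h.
by case: (constructive_indefinite_description _ h) => z Pz [<-].
Qed.

Lemma fspace_find_complete (P : pred fspace) :
  (exists x, P x) -> exists n, fspace_find P n.
Proof.
by move=> h; exists 0%N; rewrite /fspace_find; case: excluded_middle_informative.
Qed.

Lemma fspace_find_ext (P Q : pred fspace) :
  P =1 Q -> fspace_find P =1 fspace_find Q.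
Proof. by move=> /functional_extensionality ->. Qed.

HB.instance Definition _ := hasChoice.Build fspace
  fspace_find_correct fspace_find_complete fspace_find_ext.

Lemma fspaceP (x y : fspace) : (forall b, x b = y b) <-> x = y.
Proof. by split=> [h|->//]; apply: functional_extensionality. Qed.

Definition fadd (x y : fspace) : fspace := fun b => x b + y b.
Definition fopp (x : fspace) : fspace := fun b => - x b.
Definition fzero : fspace := fun=> 0.
Definition fscale (c : K) (x : fspace) : fspace := fun b => c * x b.

Fact faddA : associative fadd.
Proof. by move=> x y z; apply/fspaceP => b; rewrite /fadd addrA. Qed.
Fact faddC : commutative fadd.
Proof. by move=> x y; apply/fspaceP => b; rewrite /fadd addrC. Qed.
Fact fadd0 : left_id fzero fadd.
Proof. by move=> x; apply/fspaceP => b; rewrite /fadd add0r. Qed.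
Fact faddN : left_inverse fzero fopp fadd.
Proof. by move=> x; apply/fspaceP => b; rewrite /fadd addNr. Qed.

HB.instance Definition _ := GRing.isZmodule.Build fspace faddA faddC fadd0 faddN.

Fact fscaleA a b v : fscale a (fscale b v) = fscale (a * b) v.
Proof. by apply/fspaceP => x; rewrite /fscale mulrA. Qed.
Fact fscale1 : left_id 1 fscale.
Proof. by move=> v; apply/fspaceP => x; rewrite /fscale mul1r. Qed.
Fact fscaleDr : right_distributive fscale +%R.
Proof. by move=> a u v; apply/fspaceP => x; rewrite /fscale mulrDr. Qed.
Fact fscaleDl v : {morph fscale^~ v : a b / a + b}.
Proof. by move=> a b; apply/fspaceP => x; rewrite /fscale mulrDl. Qed.

HB.instance Definition _ := GRing.Zmodule_isLmodule.Build K fspace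
  fscaleA fscale1 fscaleDr fscaleDl.

Lemma faddE (x y : fspace) b : (x + y) b = x b + y b. Proof. by []. Qed.
Lemma foppE (x : fspace) b : (- x) b = - x b. Proof. by []. Qed.
Lemma fzeroE b : (0 : fspace) b = 0. Proof. by []. Qed.
Lemma fscaleE c (x : fspace) b : (c *: x) b = c * x b. Proof. by []. Qed.
Lemma fsumE J (s : seq J) (P : pred J) (F : J -> fspace) b :
  (\sum_(j <- s | P j) F j) b = \sum_(j <- s | P j) F j b.
Proof. by elim/big_rec2: _ => // j x y _ <-. Qed.

Definition fspE := (faddE, foppE, fzeroE, fscaleE).

End FunctionSpace.

(** * Iterates of linear maps *)

Section IterLinear.
Variables (K : fieldType) (V : lmodType K) (f : {linear V -> V}).

Lemma iter_linear0 n : iter n f 0 = 0.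
Proof. by elim: n => //= n ->; rewrite linear0. Qed.

Lemma iter_linearZ n c x : iter n f (c *: x) = c *: iter n f x.
Proof. by elim: n => //= n ->; rewrite linearZ. Qed.

Lemma iter_linearD n x y : iter n f (x + y) = iter n f x + iter n f y.
Proof. by elim: n => //= n ->; rewrite linearD. Qed.

Lemma iter_eq0_leq m n x : (m <= n)%N -> iter m f x = 0 -> iter n f x = 0.
Proof. by move=> /subnK <- h; rewrite iterD h iter_linear0. Qed.

End IterLinear.

(** * Injectivity of powers in [sl_2] representations *)

Section Sl2.
Variables (K : fieldType) (V : lmodType K) (e f a : {linear V -> V}).
Hypothesis charK : [pchar K] =i pred0.
Hypothesis ef : forall y, e (f y) = f (e y) + a y.
Hypothesis ae : forall y, a (e y) = e (a y) + 2 *: e y.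
Hypothesis af : forall y, a (f y) = f (a y) - 2 *: f y.

Lemma sl2_a_iterf m y :
  a (iter m f y) = iter m f (a y) - (2 * m%:R) *: iter m f y.
Proof.
elim: m => [|m IH] /=; first by rewrite mulr0 scale0r subr0.
rewrite af IH linearB linearZ /= -addrA -opprD -scalerDl; congr (_ - _ *: _).
by rewrite -natr1; ring.
Qed.

Lemma sl2_e_iterf m y :
  e (iter m.+1 f y) = iter m.+1 f (e y) + m.+1%:R *: iter m f (a y)
                      - (m.+1%:R * m%:R) *: iter m f y.
Proof.
elim: m => [|m IH].
  by rewrite /= ef mulr0 scale0r subr0 scale1r.
rewrite iterS ef IH sl2_a_iterf linearB linearD !linearZ /= -!iterS.
rewrite addrACA -!scalerDl -!addrA; congr (_ + _).
rewrite !addrA -[X in _ + X + _]scale1r -scalerDl.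
by congr (_ *: _ + _ *: _); rewrite -!natr1; ring.
Qed.

(** On a highest weight vector, [e f^(k+1) y = (k+1)(m-k) f^k y], and the coefficient is nonzero in
    characteristic 0 as long as [k < m]. Hence each power of [f] up to the [m]-th can be undone. *)
Lemma sl2_highest_inj (m : int) (k : nat) y : (k%:Z <= m)%R -> e y = 0 ->
  a y = m%:~R *: y -> iter k f y = 0 -> y = 0.
Proof.
move=> km ey ay; elim: k km => [|k IH] km //= fy.
apply: IH; first lia.
have := sl2_e_iterf k y; rewrite /= fy linear0 ey.
rewrite iter_linear0 linear0 ay iter_linearZ add0r scalerA -scalerBl.
move=> /esym/eqP; rewrite scaler_eq0 => /orP[|/eqP//].
have -> : k.+1%:R * m%:~R - k.+1%:R * k%:R = (k.+1 * `|m - k%:Z|)%:R :> K.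
  have -> : m = k%:Z + `|m - k%:Z|%N by lia.
  by rewrite -mulrBr natrM rmorphD /= -!pmulrn addrAC subrr add0r; congr (_ * _%:R); lia.
by have /pcharf0P -> := charK; rewrite muln_eq0 /=; lia.
Qed.

(** Induction on the nilpotency order of [e] at [y]. Since [f^m y = 0], commuting [e] past [f^(m+2)]
    gives [f^(m+2) (e y) = 0], where [e y] has weight [m+2]; so [e y = 0] and the highest weight
    case applies. *)
Lemma sl2_pow_inj (m n : nat) y : iter n e y = 0 ->
  a y = m%:R *: y -> iter m f y = 0 -> y = 0.
Proof.
elim: n m y => [|n IH] m y //= ney ay fy.
have ey : e y = 0.
  apply: (IH m.+2); first by rewrite -iterSr.
    by rewrite ae ay linearZ /= -scalerDl -[m.+2]addn2 natrD.
  have := sl2_e_iterf m.+1 y.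
  rewrite ay iter_linearZ [iter m.+1 f y]/= [iter m.+2 f y]/= fy !linear0.
  by rewrite ?oppr0 ?addr0 => <-.
by apply: (@sl2_highest_inj m%:Z m).
Qed.

End Sl2.

(** * Chevalley operators on functions of words *)

Section WordModule.
Variables (r : nat) (C : 'I_r.+1 -> 'I_r.+1 -> int) (lam : weight r).
Variable K : fieldType.
Local Notation I := 'I_r.+1.
Local Notation V := (fspace (seq I) K).

Definition eop (i : I) (y : V) : V := fun b => y (i :: b).

(** Common form of two diagonal operators: the action of [h_k] ([aop]) and the diagonal part of
    [Xop]. *)
Definition wop (c : K) (t : I -> K) (y : V) : V :=
  fun b => (c + \sum_(x <- b) t x) * y b.

Definition aop (k : I) : V -> V := wop (lam k)%:~R (fun x => - (C x k)%:~R).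

(** The relation [e_i f_k = f_k e_i + delta_ik h_k], read as a recursion on the word. The value at
    the empty word is 0 because [v_lam^*] vanishes on the image of [f_k]. *)
Fixpoint fop_word (k : I) (b : seq I) (y : V) : K :=
  if b is i :: b' then fop_word k b' (eop i y) + (i == k)%:R * aop k y b'
  else 0.

Definition fop (k : I) (y : V) : V := fun b => fop_word k b y.

Fact eop_is_linear i : linear (eop i).
Proof. by move=> c u v; apply/fspaceP => b. Qed.
HB.instance Definition _ i :=
  GRing.isLinear.Build K V V *:%R (eop i) (eop_is_linear i).

Fact wop_is_linear c t : linear (wop c t).
Proof. move=> d u v; apply/fspaceP => b; rewrite !fspE /wop !fspE; by ring. Qed.
HB.instance Definition _ c t :=
  GRing.isLinear.Build K V V *:%R (wop c t) (wop_is_linear c t).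
HB.instance Definition _ k := GRing.Linear.on (aop k).

Fact fop_is_linear k : linear (fop k).
Proof.
move=> c u v; apply/fspaceP => b; elim: b c u v => [|i b IH] c u v.
  by rewrite !fspE /fop /= mulr0 addr0.
have := IH c (eop i u) (eop i v); rewrite -linearP !fspE /fop /= => ->.
rewrite linearP /= !fspE; ring.
Qed.
HB.instance Definition _ k :=
  GRing.isLinear.Build K V V *:%R (fop k) (fop_is_linear k).

Lemma fop_nil k y : fop k y [::] = 0. Proof. by []. Qed.

Lemma fop_cons k y i b :
  fop k y (i :: b) = fop k (eop i y) b + (i == k)%:R * aop k y b.
Proof. by []. Qed.

Lemma eop_fop i k y : eop i (fop k y) = fop k (eop i y) + (i == k)%:R *: aop k y.
Proof. by apply/fspaceP => b; rewrite !fspE /eop fop_cons. Qed.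

Lemma eop_wop c t i y : eop i (wop c t y) = wop c t (eop i y) + t i *: eop i y.
Proof. by apply/fspaceP => b; rewrite !fspE /eop /wop big_cons; ring. Qed.

Lemma wop_fop c t k y : wop c t (fop k y) = fop k (wop c t y) + t k *: fop k y.
Proof.
apply/fspaceP => b; elim: b c y => [|i b IH] c y.
  by rewrite !fspE /wop !fop_nil !mulr0 addr0.
(* Passing [e_i] through the diagonal operator shifts its constant by [t i], which is why the
   induction is over all [c]. *)
have ew : eop i (wop c t y) = wop (c + t i) t (eop i y).
  by rewrite eop_wop; apply/fspaceP => b'; rewrite !fspE /wop; ring.
rewrite !fspE !fop_cons ew.
have := IH (c + t i) (eop i y); rewrite !fspE {1}/wop -addrA => IHb.
rewrite {1}/wop big_cons fop_cons mulrDr IHb /aop /wop.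
by case: eqP => [<-|_]; rewrite ?mul0r ?mulr0; ring.
Qed.

Lemma aop_fop i k y : aop i (fop k y) = fop k (aop i y) - (C k i)%:~R *: fop k y.
Proof. by rewrite /aop wop_fop scaleNr. Qed.

Lemma eop_aop i k y : eop i (aop k y) = aop k (eop i y) - (C i k)%:~R *: eop i y.
Proof. by rewrite /aop eop_wop scaleNr. Qed.

Definition cont (b : seq I) : rootv r := \sum_(x <- b) simple_root x.

(** Such a [y] is a vector of weight [lam - d]; [wt d k] is the pairing of that weight with the
    coroot of index [k]. *)
Definition hom (d : rootv r) (y : V) := forall b, y b != 0 -> cont b = d.

Definition wt (d : rootv r) (k : I) : int := lam k - \sum_(q : I) d q * C q k.

Lemma cont_cons i b : cont (i :: b) = simple_root i + cont b.
Proof. by rewrite /cont big_cons. Qed.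

Lemma cont_cat b1 b2 : cont (b1 ++ b2) = cont b1 + cont b2.
Proof. by rewrite /cont big_cat. Qed.

Lemma cont_ge0 b k : 0 <= cont b k.
Proof.
elim: b => [|i b IH]; first by rewrite /cont big_nil ffunE.
by rewrite cont_cons !ffunE addr_ge0.
Qed.

Lemma sum_simple_root (p : I) (g : I -> int) :
  \sum_(q : I) simple_root p q * g q = g p.
Proof.
rewrite (bigD1 p) //= ffunE eqxx mul1r big1 ?addr0 // => q /negbTE nq.
by rewrite ffunE nq mul0r.
Qed.

Lemma sum_cont (g : I -> int) b :
  \sum_(x <- b) g x = \sum_(q : I) cont b q * g q.
Proof.
elim: b => [|i b IH].
  by rewrite big_nil big1 // => q _; rewrite /cont big_nil ffunE mul0r.
rewrite big_cons IH cont_cons.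
under [RHS]eq_bigr do rewrite ffunE mulrDl.
by rewrite big_split /= sum_simple_root.
Qed.

Lemma hom_aop d k y : hom d y -> aop k y = (wt d k)%:~R *: y.
Proof.
move=> hy; apply/fspaceP => b; rewrite fspE /aop /wop.
have [->|yb] := eqVneq (y b) 0; first by rewrite !mulr0.
congr (_ * _); rewrite /wt -(hy _ yb) -sum_cont rmorphB rmorph_sum /=.
by rewrite sumrN.
Qed.

Lemma hom_eop d i y : hom d y -> hom (d - simple_root i) (eop i y).
Proof. by move=> hy b /hy <-; rewrite cont_cons addrC addrA addNr add0r. Qed.

Lemma fop_local d k (y1 y2 : V) :
  (forall b, cont b = d -> y1 b = y2 b) ->
  forall b, cont b = d + simple_root k -> fop k y1 b = fop k y2 b.
Proof.
move=> h b; elim: b d y1 y2 h => [|i b IH] d y1 y2 h; first by rewrite !fop_nil.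
rewrite cont_cons => hb; rewrite !fop_cons; congr (_ + _).
  apply: (IH (d - simple_root i)) => [b' hb'|].
    by apply: h; rewrite cont_cons hb' addrC subrK.
  by rewrite addrAC -hb addrC addKr.
case: eqP hb => [->|_] hb; last by rewrite !mul0r.
rewrite /aop /wop (h b) //.
by apply: (addrI (simple_root k)); rewrite hb addrC.
Qed.

Lemma iter_fop_local m d k (y1 y2 : V) :
  (forall b, cont b = d -> y1 b = y2 b) ->
  forall b, cont b = d + simple_root k *+ m ->
    iter m (fop k) y1 b = iter m (fop k) y2 b.
Proof.
move=> h; elim: m => [|m IH] b hb; first by apply: h; rewrite hb addr0.
by apply: (fop_local IH); rewrite hb mulrSr addrA.
Qed.

Lemma hom_fop d k y : hom d y -> hom (d + simple_root k) (fop k y).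
Proof.
move=> hy b fb; apply/eqP; apply: contraNT fb => hb; apply/eqP.
rewrite (@fop_local (cont b - simple_root k) k y 0) ?subrK //.
  by rewrite linear0.
move=> b' hb'; apply/eqP; apply: contraNT hb => /hy.
by rewrite hb' => <-; rewrite subrK.
Qed.

Lemma hom_iter_fop m d k y : hom d y -> hom (d + simple_root k *+ m) (iter m (fop k) y).
Proof.
move=> hy; elim: m => [|m IH]; first by rewrite addr0.
by rewrite mulrSr addrA; apply: hom_fop.
Qed.

Lemma hom_iter_eop m d k y : hom d y -> hom (d - simple_root k *+ m) (iter m (eop k) y).
Proof.
move=> hy; elim: m => [|m IH]; first by rewrite subr0.
by rewrite mulrSr opprD addrA; apply: hom_eop.
Qed.

Lemma hom_scale d c y : hom d y -> hom d (c *: y).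
Proof. by move=> hy b; rewrite fspE mulf_eq0 negb_or => /andP[_ /hy]. Qed.

Lemma hom_ge0 d y : hom d y -> (exists k, d k < 0) -> y = 0.
Proof.
move=> hy [k dk]; apply/fspaceP => b; apply/eqP; apply: contraTT dk => /hy <-.
by rewrite -leNgt cont_ge0.
Qed.

Lemma iter_eop_hom d y k : hom d y -> exists n, iter n (eop k) y = 0.
Proof.
move=> hy; exists `|d k|%N.+1; apply: (hom_ge0 (hom_iter_eop hy)).
have lt0 (x : int) : x - `|x|%N.+1%:Z < 0 by lia.
by exists k; rewrite !ffunE ffunMnE !ffunE eqxx -mulr_natr mul1r natz; apply: lt0.
Qed.

Hypothesis Cdiag : forall i, C i i = 2.
Hypothesis Csym : forall i j, C i j = C j i.
Hypothesis Coff : forall i j, i != j -> C i j = 0 \/ C i j = -1.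
Hypothesis charK : [pchar K] =i pred0.

Lemma fop_comm i j y : C i j = 0 -> fop i (fop j y) = fop j (fop i y).
Proof.
move=> Cij; apply/fspaceP => b; elim: b y => [|k b IH] y; first by [].
have Cji : C j i = 0 by rewrite Csym.
rewrite !fop_cons !eop_fop !linearD !linearZ /= !aop_fop !fspE IH Cij Cji.
by ring.
Qed.

(** Induction on the word: both sides vanish at the empty word, and [e_k] turns the relation for [y]
    into the relation for [e_k y] plus terms in [h_i] and [h_j], which cancel by the values of the
    Cartan entries. No quotient has to be taken. *)
Lemma serre i j y : C i j = -1 ->
  fop i (fop i (fop j y)) = 2 *: fop i (fop j (fop i y)) - fop j (fop i (fop i y)).
Proof.
move=> Cij; apply/fspaceP => b; elim: b y => [|k b IH] y.
  by rewrite !fspE !fop_nil mulr0 subr0.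
rewrite !fspE !fop_cons.
do 3 rewrite ?eop_fop ?linearD ?linearZ /= ?aop_fop ?linearB ?linearZ /=.
rewrite !fspE IH !fspE.
have Cji : C j i = -1 by rewrite Csym.
rewrite Cij Cji Cdiag.
by ring.
Qed.

(** The iterated Serre relation; it shows that [f_j] preserves local nilpotency of [f_i]. *)
Lemma iter_fop_serre i j n y : C i j = -1 ->
  iter n.+1 (fop i) (fop j y) =
    n.+1%:R *: fop i (fop j (iter n (fop i) y)) - n%:R *: fop j (iter n.+1 (fop i) y).
Proof.
move=> Cij; elim: n => [|n IH]; first by rewrite /= scale1r scale0r subr0.
rewrite iterS IH linearB !linearZ /= serre //.
by apply/fspaceP => b; rewrite !fspE -!natr1; ring.
Qed.

(** Required for all [i], this is the integrability condition on a vector; it is stable under all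
    [e_j] and [f_j]. *)
Definition nilf i y := exists n, iter n (fop i) y = 0.

Lemma nilf_iter i y m : nilf i y -> nilf i (iter m (fop i) y).
Proof. by case=> n h; exists n; rewrite -iterD addnC iterD h iter_linear0. Qed.

Lemma nilf_scale i c y : nilf i y -> nilf i (c *: y).
Proof. by case=> n h; exists n; rewrite iter_linearZ h scaler0. Qed.

Lemma nilf_add i x y : nilf i x -> nilf i y -> nilf i (x + y).
Proof.
move=> [m hm] [n hn]; exists (maxn m n); rewrite iter_linearD.
by rewrite (iter_eq0_leq _ hm) ?leq_maxl // (iter_eq0_leq _ hn) ?leq_maxr ?addr0.
Qed.

Lemma nilf_sum i J (s : seq J) (P : pred J) F :
  (forall j, P j -> nilf i (F j)) -> nilf i (\sum_(j <- s | P j) F j).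
Proof.
move=> h; elim/big_ind: _ => //; first by exists 0%N.
by move=> x y; apply: nilf_add.
Qed.

Lemma nilf_fop i j y : nilf i y -> nilf i (fop j y).
Proof.
have [<-|/eqP nij] := eqVneq i j; first exact: (nilf_iter 1).
have [Cij|Cij] := Coff (introN eqP nij); case=> n h.
  exists n; rewrite (_ : iter n _ _ = fop j (iter n (fop i) y)); first by rewrite h linear0.
  by elim: (n) => //= m ->; rewrite fop_comm.
by exists n.+1; rewrite iter_fop_serre // iterS h !linear0 addr0.
Qed.

Lemma sl2_ef i y : eop i (fop i y) = fop i (eop i y) + aop i y.
Proof. by rewrite eop_fop eqxx scale1r. Qed.
Lemma sl2_ae i y : aop i (eop i y) = eop i (aop i y) + 2 *: eop i y.
Proof. by rewrite eop_aop Cdiag subrK. Qed.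
Lemma sl2_af i y : aop i (fop i y) = fop i (aop i y) - 2 *: fop i y.
Proof. by rewrite aop_fop Cdiag. Qed.

Lemma aop_iter i n y :
  iter n (fop i) (aop i y) = aop i (iter n (fop i) y) + (2 * n%:R) *: iter n (fop i) y.
Proof. by rewrite (sl2_a_iterf (sl2_af i)) subrK. Qed.

Lemma nilf_eop i j y : nilf i y -> nilf i (eop j y).
Proof.
case=> n h; have [<-|/negbTE nij] := eqVneq i j.
  exists n.+1; have := sl2_e_iterf (sl2_ef i) (sl2_af i) n y.
  rewrite aop_iter h [iter n.+1 (fop i) y]/= h !linear0 addr0.
  by rewrite !(addr0, scaler0) => <-.
exists n; rewrite (_ : iter n _ _ = eop j (iter n (fop i) y)); first by rewrite h linear0.
by elim: (n) => //= m ->; rewrite eop_fop eq_sym nij scale0r addr0.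
Qed.


End WordModule.

(** * Reflections of roots and weights *)

Section Roots.
Variables (r : nat) (C : 'I_r.+1 -> 'I_r.+1 -> int).
Local Notation I := 'I_r.+1.
Hypothesis Cdiag : forall i, C i i = 2.
Hypothesis Csym : forall i j, C i j = C j i.

Lemma srefl_rE i b :
  srefl_r C i b = b - simple_root i *~ (\sum_(q : I) b q * C q i).
Proof.
apply/ffunP => k; rewrite !ffunE ffunMzE ffunE.
case: eqP => [->|_]; first by rewrite intz.
by rewrite mul0rz oppr0 addr0.
Qed.

Lemma srefl_r_lin i b c : srefl_r C i (b - c) = srefl_r C i b - srefl_r C i c.
Proof.
apply/ffunP => k; rewrite !ffunE; case: eqP => // _.
rewrite opprD addrACA -opprD -sumrB; congr (_ - _).
by apply: eq_bigr => q _; rewrite !ffunE mulrBl.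
Qed.

Lemma srefl_rK i : involutive (srefl_r C i).
Proof.
move=> b; rewrite (srefl_rE i (srefl_r C i b)).
rewrite (_ : \sum_q _ = - \sum_(q : I) b q * C q i).
  by rewrite mulrNz opprK srefl_rE subrK.
rewrite srefl_rE.
under eq_bigr => q _ do rewrite !ffunE ffunMzE ffunE mulrBl.
rewrite sumrB [X in _ - X](bigD1 i) //= eqxx [X in _ - (_ + X)]big1 ?addr0; last first.
  by move=> q /negbTE ->; rewrite mul0rz mul0r.
by rewrite Cdiag; set s := \sum_q _; rewrite intz; ring.
Qed.

(** The coordinate product pairs fundamental weights with simple coroots, roots being identified
    with coroots by symmetry of [C]; reflections are self-adjoint for it. *)
Lemma pair_srefl i (mu : weight r) (b : rootv r) :
  \sum_k srefl_w C i mu k * b k = \sum_k mu k * srefl_r C i b k.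
Proof.
under eq_bigr => k _ do rewrite ffunE mulrBl.
rewrite sumrB srefl_rE.
under [RHS]eq_bigr => k _ do rewrite !ffunE ffunMzE ffunE mulrBr.
rewrite sumrB; congr (_ - _).
rewrite [RHS](bigD1 i) //= eqxx [X in _ = _ + X]big1 ?addr0; last first.
  by move=> q /negbTE ->; rewrite mul0rz mulr0.
rewrite intz mulr_sumr; apply: eq_bigr => k _; rewrite (Csym k i); ring.
Qed.

Lemma pair_wact u (mu : weight r) (b : rootv r) :
  \sum_k wact C u mu k * b k = \sum_k mu k * ract C (rev u) b k.
Proof.
elim: u b => [//|i u IH] b; rewrite [wact _ _ _]/= pair_srefl IH.
by rewrite rev_cons /ract foldr_rcons.
Qed.

Lemma wact_simple u (mu : weight r) i :
  wact C u mu i = \sum_k mu k * ract C (rev u) (simple_root i) k.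
Proof.
rewrite -pair_wact -(sum_simple_root i); apply: eq_bigr => q _.
by rewrite mulrC.
Qed.

Lemma ract_rev u b : ract C u (ract C (rev u) b) = b.
Proof.
elim: u b => //= i u IH b; rewrite rev_cons /ract foldr_rcons.
by rewrite -/(ract C _ _) -/(ract C (rev u) _) IH srefl_rK.
Qed.

Lemma ract0 u : ract C u 0 = 0.
Proof.
by elim: u => //= i u ->; rewrite -{1}[0](subrr (0 : rootv r)) srefl_r_lin subrr.
Qed.

Lemma simple_root_neq0 i : simple_root i != 0 :> rootv r.
Proof. by apply/eqP => /ffunP/(_ i); rewrite !ffunE eqxx. Qed.

Lemma ract_simple_neq0 u i : ract C u (simple_root i) != 0.
Proof.
apply: contraNneq (simple_root_neq0 i) => h.
by rewrite -[simple_root i](ract_rev (rev u)) revK h ract0.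
Qed.

(** Reducedness in the form suited to induction on the word: [u'^-1 alpha_i] is positive at each
    suffix [i :: u'], since [rev u'] represents the inverse of [u']. *)
Fixpoint left_reduced (u : seq I) : Prop :=
  if u is i :: u' then
    (forall k, 0 <= ract C (rev u') (simple_root i) k) /\ left_reduced u'
  else True.

Lemma left_reduced_pos i u : (forall k, 0 <= ract C (rev u) (simple_root i) k) ->
  exists k, 0 < ract C (rev u) (simple_root i) k.
Proof.
move=> h; apply/existsP; apply: contraR (ract_simple_neq0 (rev u) i).
rewrite negb_exists => /forallP hk; apply/eqP/ffunP => k; rewrite [RHS]ffunE.
by apply/eqP; rewrite eq_le h andbT leNgt.
Qed.

End Roots.

(** * Weights of the integrable module and extremal vectors *)

Section Extremal.
Variables (r : nat) (C : 'I_r.+1 -> 'I_r.+1 -> int) (lam : weight r).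
Variable K : fieldType.
Local Notation I := 'I_r.+1.
Local Notation V := (fspace (seq I) K).
Hypothesis Cdiag : forall i, C i i = 2.
Hypothesis Csym : forall i j, C i j = C j i.
Hypothesis Coff : forall i j, i != j -> C i j = 0 \/ C i j = -1.
Hypothesis charK : [pchar K] =i pred0.
Hypothesis lam_ge0 : forall i, 0 <= lam i.

Local Notation e := (@eop r K).
Local Notation f := (@fop r C lam K).
Local Notation a := (@aop r C lam K).
Local Notation wt := (wt C lam).

(** Determined by [s_i (lam - d) = lam - refl_d i d]. *)
Definition refl_d (i : I) (d : rootv r) : rootv r := d + simple_root i *~ wt d i.

Lemma wt_refl i d k : wt (refl_d i d) k = wt d k - wt d i * C i k.
Proof.
rewrite {1}/wt -[in RHS]/(wt d k) {2}/wt.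
under eq_bigr => q _ do rewrite ffunE ffunMzE mulrDl.
rewrite big_split /= opprD addrA; congr (_ - _).
rewrite -(sum_simple_root i (fun q => wt d i * C q k)); apply: eq_bigr => q _.
by rewrite -mulrzr intz mulrA.
Qed.

Lemma refl_dB i d b : refl_d i (d - b) = refl_d i d - srefl_r C i b.
Proof.
rewrite srefl_rE /refl_d opprB.
have -> : wt (d - b) i = wt d i + \sum_q b q * C q i.
  rewrite /wt -addrA; congr (_ + _); apply: oppr_inj; rewrite opprD !opprK.
  by rewrite -sumrB; apply: eq_bigr => q _; rewrite !ffunE mulrBl.
by rewrite mulrzDr [X in _ = _ + X]addrC addrACA.
Qed.

Lemma refl_dK i : involutive (refl_d i).
Proof.
move=> d; rewrite {1}/refl_d wt_refl Cdiag {1}/refl_d -addrA -mulrzDr.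
rewrite (_ : wt d i + _ = 0) ?mulr0z ?addr0 //; ring.
Qed.

(** Says that [lam - d] is not the weight of a nonzero integrable vector. *)
Definition vanishing (d : rootv r) :=
  forall y : V, hom d y -> (forall i, nilf C lam i y) -> y = 0.

(** On a vector whose [h_i]-weight has absolute value [m], the operator [f_i^m] or [e_i^m],
    according to the sign, is injective and lands in the reflected weight space, which is zero. *)
Lemma vanishing_refl i d : vanishing (refl_d i d) -> vanishing d.
Proof.
move=> vd y hy ny; have ay := hom_aop C lam i hy.
have [n en] := iter_eop_hom i hy.
case wd: (wt d i) => [m|m].
  apply: (@sl2_pow_inj K V (e i) (f i) (a i) charK _ _ _ m n) en _ _.
  - exact: sl2_ef.
  - exact: sl2_ae.
  - exact: sl2_af.
  - by rewrite /= ay wd.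
  apply: vd => [|j].
    by rewrite /refl_d wd; apply: hom_iter_fop.
  elim: (m) => //= k; exact: nilf_fop.
have [k fk] := ny i.
(* For negative weight [e_i] and [f_i] exchange roles, with [- h_i] in place of [h_i]; nilpotency
   now comes from integrability. *)
pose b : {linear V -> V} := \- (a i).
apply: (@sl2_pow_inj K V (f i) (e i) b charK _ _ _ m.+1 k) fk _ _.
- by move=> z; rewrite /b /= (sl2_ef C lam i z) addrK.
- by move=> z; rewrite /b /= sl2_af // linearN opprB addrC.
- by move=> z; rewrite /b /= sl2_ae // linearN opprD.
- by rewrite /b /= ay wd -scaleNr NegzE rmorphN opprK.
apply: vd => [|j].
  by rewrite /refl_d wd NegzE mulrNz; apply: hom_iter_eop.
elim: (m.+1) => //= l; exact: nilf_eop.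
Qed.

Definition vlam : V := fun b => (b == [::])%:R.

Lemma eop_vlam i : e i vlam = 0.
Proof. by apply/fspaceP. Qed.

Lemma hom_vlam : hom 0 vlam.
Proof.
by case=> [|i b]; rewrite /vlam ?eqxx // /cont big_nil.
Qed.

(** The vector [f_i^(lam_i+1) v_lam] is killed by every [e_k], so it vanishes at all nonempty words;
    at the empty word it vanishes as an image of [f_i]. *)
Lemma nilf_vlam i : nilf C lam i vlam.
Proof.
exists `|lam i|%N.+1; apply/fspaceP => -[|k b]; first by [].
rewrite -[LHS]/(e k (iter `|lam i|%N.+1 (f i) vlam) b).
have [->|/negbTE nki] := eqVneq k i.
  rewrite (sl2_e_iterf (sl2_ef C lam i) (sl2_af lam Cdiag i)) /= eop_vlam.
  rewrite iter_linear0 linear0 add0r (hom_aop C lam i hom_vlam) iter_linearZ.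
  rewrite scalerA -scalerBl (_ : _ - _ = 0) ?scale0r //.
  rewrite /wt big1 => [|q _]; last by rewrite ffunE mul0r.
  rewrite subr0 -mulrBr; case: (lam i) (lam_ge0 i) => // n _.
  by rewrite -pmulrn subrr mulr0.
rewrite (_ : e k _ = 0) //; elim: (`|lam i|%N.+1) => [|n IH]; first exact: eop_vlam.
by rewrite iterS eop_fop IH linear0 nki scale0r addr0.
Qed.

Fixpoint vec (u : seq I) : V :=
  if u is i :: u' then
    let m := `|wact C u' lam i|%N in (m`!)%:R^-1 *: iter m (f i) (vec u')
  else vlam.

Fixpoint dvec (u : seq I) : rootv r :=
  if u is i :: u' then refl_d i (dvec u') else 0.

Lemma wt_dvec u k : wt (dvec u) k = wact C u lam k.
Proof.
elim: u k => [|i u IH] k /=.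
  by rewrite /wt big1 ?subr0 // => q _; rewrite ffunE mul0r.
by rewrite wt_refl !IH ffunE.
Qed.

Lemma left_reduced_ge0 i u : (forall k, 0 <= ract C (rev u) (simple_root i) k) ->
  0 <= wact C u lam i.
Proof.
by move=> h; rewrite wact_simple //; apply: sumr_ge0 => k _; rewrite mulr_ge0.
Qed.

Lemma vec_hom_nilf u : left_reduced C u ->
  hom (dvec u) (vec u) /\ forall i, nilf C lam i (vec u).
Proof.
elim: u => [|i u IH] /=; first by split; [apply: hom_vlam | apply: nilf_vlam].
case=> hi /IH[hh hn]; split.
  rewrite /refl_d wt_dvec -{1}[wact C u lam i]gez0_abs ?left_reduced_ge0 //.
  by apply/hom_scale/hom_iter_fop.
move=> j; apply: nilf_scale; elim: (absz _) => //= n; exact: nilf_fop.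
Qed.

(** The weight in question is [u lam + b]. Reflecting back along [u] turns it into [lam + u^-1 b],
    which does not lie below [lam]. *)
Lemma vanishing_dvec u b : (exists k, 0 < ract C (rev u) b k) ->
  vanishing (dvec u - b).
Proof.
elim: u b => [|i u IH] b.
  case=> k hk y hy _; apply: (hom_ge0 hy); exists k.
  by rewrite /= !ffunE add0r oppr_lt0.
rewrite rev_cons /ract foldr_rcons => /IH h.
by apply: (@vanishing_refl i); rewrite /= refl_dB refl_dK.
Qed.

(** The vector [e_i v_{u lam}] would have weight [u lam + alpha_i = u (lam + u^-1 alpha_i)] with
    [u^-1 alpha_i] positive. *)
Lemma eop_vec i u : left_reduced C (i :: u) -> e i (vec u) = 0.
Proof.
case=> hi /vec_hom_nilf[hh hn].
apply: (@vanishing_dvec u (simple_root i)); first exact: left_reduced_pos.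
  exact: hom_eop.
by move=> j; apply: nilf_eop.
Qed.

End Extremal.

(** * The eigenvector series and its behaviour under a simple reflection *)

Section Eigenvector.
Variables (r : nat) (C : 'I_r.+1 -> 'I_r.+1 -> int) (lam : weight r).
Variable K : fieldType.
Local Notation I := 'I_r.+1.
Local Notation V := (fspace (seq I) K).
Hypothesis Cdiag : forall i, C i i = 2.
Hypothesis Csym : forall i j, C i j = C j i.
Hypothesis Coff : forall i j, i != j -> C i j = 0 \/ C i j = -1.

Local Notation e := (@eop r K).
Local Notation f := (@fop r C lam K).
Local Notation a := (@aop r C lam K).
Local Notation wt := (wt C lam).

Definition hlin (h : I -> K) (b : rootv r) : K := \sum_k (b k)%:~R * h k.

(** Makes the denominators of [Dwd] nonzero, separates the eigenvalues of different contents, and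
    forces characteristic 0. *)
Definition generic (h : I -> K) := forall b, b != 0 -> hlin h b != 0.

(** The value of [h] at the root [s_i alpha_k]. *)
Definition srefl_h (i : I) (h : I -> K) : I -> K :=
  fun k => h k - (C k i)%:~R * h i.

Definition hw (h : I -> K) (b : seq I) : K := \sum_(x <- b) h x.

Lemma hlinD h b c : hlin h (b + c) = hlin h b + hlin h c.
Proof.
by rewrite -big_split; apply: eq_bigr => k _; rewrite ffunE rmorphD mulrDl.
Qed.

Lemma hlinN h b : hlin h (- b) = - hlin h b.
Proof. by rewrite -sumrN; apply: eq_bigr => k _; rewrite ffunE rmorphN mulNr. Qed.

Lemma hlin0 h : hlin h 0 = 0.
Proof. by rewrite /hlin big1 // => k _; rewrite ffunE mul0r. Qed.

Lemma hlinMz h b z : hlin h (b *~ z) = z%:~R * hlin h b.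
Proof.
rewrite mulr_sumr; apply: eq_bigr => k _.
by rewrite ffunMzE -[b k *~ z]mulrzr intz rmorphM /=; ring.
Qed.

Lemma hlin_simple_root h i : hlin h (simple_root i) = h i.
Proof.
rewrite /hlin (bigD1 i) //= ffunE eqxx mul1r big1 ?addr0 // => q /negbTE nq.
by rewrite ffunE nq mul0r.
Qed.

Lemma hw_cont h b : hw h b = hlin h (cont b).
Proof.
elim: b => [|x b IH]; first by rewrite /hw /cont !big_nil hlin0.
by rewrite cont_cons hlinD hlin_simple_root -IH /hw big_cons.
Qed.

Lemma hlin_srefl i h b : hlin (srefl_h i h) b = hlin h (srefl_r C i b).
Proof.
rewrite srefl_rE hlinD hlinN hlinMz hlin_simple_root /hlin /srefl_h.
under eq_bigr => k _ do rewrite mulrBr.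
rewrite sumrB rmorph_sum mulr_suml; congr (_ - _).
by apply: eq_bigr => k _; rewrite rmorphM mulrA.
Qed.

Lemma generic_srefl i h : generic h -> generic (srefl_h i h).
Proof.
move=> gh b b0; rewrite hlin_srefl; apply: gh; apply: contraNneq b0 => s0.
by rewrite -[b](srefl_rK Cdiag i) s0; apply/eqP/(ract0 C [:: i]).
Qed.

Lemma generic_neq0 h i : generic h -> h i != 0.
Proof. by move=> gh; rewrite -hlin_simple_root gh ?simple_root_neq0. Qed.

Lemma generic_char0 h : generic h -> [pchar K] =i pred0.
Proof.
move=> gh; apply/pcharf0P => n; case: n => [|n]; first by rewrite !eqxx.
have /gh : simple_root (ord0 : I) *~ n.+1%:Z != 0.
  by apply/eqP => /ffunP/(_ ord0); rewrite ffunMzE !ffunE intz.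
by rewrite hlinMz mulf_eq0 negb_or => /andP[/negbTE].
Qed.

Lemma cont_cons_gt0 (k : I) b : 0 < cont (k :: b) k.
Proof. by rewrite cont_cons !ffunE eqxx ltr_wpDr ?cont_ge0. Qed.

Lemma cont_rcons_neq0 w (k : I) : cont (rcons w k) != 0.
Proof.
apply/eqP => /ffunP/(_ k); rewrite -cats1 cont_cat !ffunE => /eqP; rewrite gt_eqF //.
by rewrite ltr_wpDl ?cont_ge0 ?cont_cons_gt0.
Qed.

Definition ht (d : rootv r) : int := \sum_k d k.

Lemma ht_cont (b : seq I) : ht (cont b) = (size b)%:Z.
Proof.
rewrite -[RHS]natz -sum1_size natr_sum (sum_cont (fun=> 1)).
by apply: eq_bigr => k _; rewrite mulr1.
Qed.

Lemma ht_addMz d (i : I) z : ht (d + simple_root i *~ z) = ht d + z.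
Proof.
rewrite -{2}(sum_simple_root i (fun=> z)) /ht -big_split; apply: eq_bigr => q _.
by rewrite ffunE ffunMzE -mulrzr intz.
Qed.

Lemma hom_size d n (y : V) b : hom d y -> ht d = n%:Z -> y b != 0 -> size b = n.
Proof. by move=> hy hd /hy hb; apply/eqP; rewrite -eqz_nat -ht_cont hb hd. Qed.

Definition Dwd (h : I -> K) (w : seq I) : K :=
  (\prod_(k < size w) hw h (take k.+1 w))^-1.

Lemma Dwd_rcons h w k : generic h -> Dwd h (rcons w k) * hw h (rcons w k) = Dwd h w.
Proof.
move=> gh; rewrite /Dwd size_rcons big_ord_recr /= take_oversize ?size_rcons //.
rewrite invfM mulrVK ?unitfE; last by rewrite hw_cont gh ?cont_rcons_neq0.
congr (_^-1); apply: eq_bigr => j _.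
by rewrite -cats1 takel_cat.
Qed.

Definition eword (w : seq I) (y : V) : V := fun b => y (w ++ b).

(** The truncation at [n] loses nothing when [v] is homogeneous of height [n]: longer words kill
    it. *)
Definition Gser (h : I -> K) (n : nat) (v : V) : V :=
  \sum_(l < n.+1) \sum_(w : l.-tuple I) Dwd h w *: eword w v.

Lemma GserE h n v b :
  Gser h n v b = \sum_(l < n.+1) \sum_(w : l.-tuple I) Dwd h w * v (w ++ b).
Proof. by rewrite /Gser fsumE; apply: eq_bigr => l _; rewrite fsumE. Qed.

Lemma sum_tuple0 (F : seq I -> K) : \sum_(w : 0.-tuple I) F w = F [::].
Proof.
rewrite (big_pred1 [tuple]) // => w /=; apply/esym/eqP/val_inj.
by case: w => [[]].
Qed.

Lemma sum_tuple_rcons l (F : seq I -> K) :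
  \sum_(w : l.+1.-tuple I) F w = \sum_(w : l.-tuple I) \sum_k F (rcons w k).
Proof.
rewrite pair_big /=.
rewrite (reindex (fun p : l.-tuple I * I => [tuple of rcons p.1 p.2])) //=.
exists (fun w : l.+1.-tuple I =>
  ([tuple of belast (thead w) (behead w)], last (thead w) (behead w))).
  move=> [w k] _ /=; rewrite /thead (tnth_nth k) /=; congr pair.
    by apply: val_inj => /=; case: (tval w) => //= x s; rewrite belast_rcons.
  by case: (tval w) => //= x s; rewrite last_rcons.
move=> w _; apply: val_inj => /=.
by case/tupleP: w => x w; rewrite theadE /= -lastI.
Qed.

Definition Xop (h : I -> K) (y : V) : V := wop 0 h y + \sum_k e k y.

Lemma XopE h y b : Xop h y b = hw h b * y b + \sum_k y (k :: b).
Proof. by rewrite /Xop faddE fsumE /wop add0r. Qed.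

Fact Xop_is_linear h : linear (Xop h).
Proof.
move=> c u v; rewrite /Xop linearP /= scalerDr -addrACA; congr (_ + _).
by rewrite scaler_sumr -big_split; apply: eq_bigr => k _; rewrite linearP.
Qed.
HB.instance Definition _ h :=
  GRing.isLinear.Build K V V *:%R (Xop h) (Xop_is_linear h).

(** In the term of [w] at [b], homogeneity turns [hlin h d - hw h b] into [hw h w]. By [Dwd_rcons]
    this factor removes the last letter of [w], so the length [l+1] part of the series matches
    [sum_k e_k] of the length [l] part. *)
Lemma Gser_eig h d n v : generic h -> hom d v -> ht d = n%:Z ->
  Xop h (Gser h n v) = hlin h d *: Gser h n v.
Proof.
move=> gh hv hd; apply/fspaceP => b; rewrite XopE fspE.
apply/eqP; rewrite addrC -subr_eq0 -addrA -mulrBl -opprB mulNr subr_eq0; apply/eqP.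
pose U w := Dwd h w * v (w ++ b).
pose S l := \sum_(w : l.-tuple I) U w.
have cU w : (hlin h d - hw h b) * U w = hw h w * U w.
  have [h0|/hv hw0] := eqVneq (v (w ++ b)) 0; first by rewrite /U h0 !mulr0.
  by rewrite -hw0 cont_cat hlinD -!hw_cont addrK.
have -> : \sum_k Gser h n v (k :: b) = \sum_(l < n.+1) (hlin h d - hw h b) * S l.+1.
  under eq_bigr => k _ do rewrite GserE.
  rewrite exchange_big; apply: eq_bigr => l _ /=.
  rewrite exchange_big mulr_sumr /=.
  rewrite (eq_bigr (fun w : l.+1.-tuple I => hw h w * U w)) => [|w _]; last exact: cU.
  rewrite (sum_tuple_rcons l (fun w => hw h w * U w)); apply: eq_bigr => w _.
  apply: eq_bigr => k _; rewrite /U mulrA [hw _ _ * _]mulrC Dwd_rcons //.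
  by rewrite cat_rcons.
rewrite GserE -mulr_sumr -[RHS]/(_ * \sum_(l < n.+1) S l).
rewrite big_ord_recr [in RHS]big_ord_recl /= !mulrDr addrC; congr (_ + _).
(* The two end terms vanish: the empty word has weight 0, and words of length [n+1] exceed the
   height of [v]. *)
rewrite [S 0%N]sum_tuple0 cU {2}/hw big_nil mul0r.
rewrite (_ : S n.+1 = 0) ?mulr0 //; apply: big1 => w _.
have [h0|/(hom_size hv hd)] := eqVneq (v (w ++ b)) 0; first by rewrite /U h0 mulr0.
rewrite size_cat size_tuple; lia.
Qed.

Lemma Gser_base h n v b : (forall w, w != [::] -> v (w ++ b) = 0) ->
  Gser h n v b = v b.
Proof.
move=> hv; rewrite GserE big_ord_recl.
rewrite (sum_tuple0 (fun w => Dwd h w * v (w ++ b))) /Dwd big_ord0 invr1 mul1r.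
rewrite big1 ?addr0 // => l _; rewrite big1 // => w _.
by rewrite hv ?mulr0 // -size_eq0 size_tuple.
Qed.

Definition wsum (h : I -> K) (n : nat) (v : V) : K :=
  \sum_(w : n.-tuple I) Dwd h w * v w.

Lemma Gser_nil h d n v : hom d v -> ht d = n%:Z -> Gser h n v [::] = wsum h n v.
Proof.
move=> hv hd; rewrite GserE big_ord_recr /= big1 ?add0r => [|l _].
  by apply: eq_bigr => w _; rewrite cats0.
rewrite big1 // => w _; rewrite cats0.
have [->|/(hom_size hv hd)] := eqVneq (v w) 0; first by rewrite mulr0.
by have := ltn_ord l; rewrite size_tuple; lia.
Qed.

Lemma nilf_Gser i h n v : nilf C lam i v -> nilf C lam i (Gser h n v).
Proof.
move=> nv; apply: nilf_sum => l _; apply: nilf_sum => w _; apply: nilf_scale.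
elim: (tval w) v nv => [|k s IH] v nv //.
by apply: (IH (e k v)); apply: nilf_eop.
Qed.

Definition bounded (y : V) := exists L, forall b, (L < size b)%N -> y b = 0.

Lemma bounded_fop i y : bounded y -> bounded (f i y).
Proof.
case=> L hL; exists L.+1 => b hb.
rewrite (@fop_local r C lam K (cont b - simple_root i) i y 0) ?subrK ?linear0 //.
move=> b' hb'; apply: hL; rewrite -ltz_nat -ht_cont hb'.
have -> : ht (cont b - simple_root i) = (size b)%:Z - 1.
  rewrite -ht_cont /ht -[1 in RHS](sum_simple_root i (fun=> 1)) -sumrB.
  by apply: eq_bigr => q _; rewrite !ffunE mulr1.
lia.
Qed.

Lemma bounded_add x y : bounded x -> bounded y -> bounded (x + y).
Proof.
move=> [L hL] [M hM]; exists (maxn L M) => b; rewrite gtn_max => /andP[h1 h2].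
by rewrite fspE hL // hM // addr0.
Qed.

Lemma bounded_scale c y : bounded y -> bounded (c *: y).
Proof. by case=> L hL; exists L => b hb; rewrite fspE hL ?mulr0. Qed.

Lemma bounded_sum J (s : seq J) (P : pred J) F :
  (forall j, P j -> bounded (F j)) -> bounded (\sum_(j <- s | P j) F j).
Proof.
move=> h; elim/big_ind: _ => //; first by exists 0%N.
by move=> x y; apply: bounded_add.
Qed.

Lemma bounded_hom d n y : hom d y -> ht d = n%:Z -> bounded y.
Proof.
move=> hy hd; exists n => b; have [//|/(hom_size hy hd) ->] := eqVneq (y b) 0.
by rewrite ltnn.
Qed.

Lemma bounded_Gser h n v : bounded v -> bounded (Gser h n v).
Proof.
move=> [L hL]; apply: bounded_sum => l _; apply: bounded_sum => w _.
apply: bounded_scale; exists L => b hb; apply: hL; rewrite size_cat; lia.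
Qed.

(** Descending induction on the length of [b]: once [y] vanishes on longer words, the eigenvalue
    equation reads [(hw h b - hlin h d) * y b = 0], and the factor is nonzero unless [b] has content
    [d]. *)
Lemma eig_unique h d y : generic h -> bounded y -> Xop h y = hlin h d *: y ->
  (forall b, cont b = d -> y b = 0) -> y = 0.
Proof.
move=> gh [L hL] hX hd; apply/fspaceP => b.
have [j] : exists j, (L < size b + j)%N by exists L.+1; lia.
elim: j b => [|j IH] b; first by rewrite addn0 => /hL.
move=> hb.
have [cb|nb] := eqVneq (cont b) d; first exact: hd.
have := congr1 (fun z : V => z b) hX; rewrite /= XopE fspE big1 => [|k _].
  move=> /eqP; rewrite addr0 -subr_eq0 -mulrBl mulf_eq0 hw_cont -hlinN -hlinD.
  by case/orP => [|/eqP //]; rewrite (negbTE (gh _ _)) // subr_eq0.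
by apply: IH => /=; rewrite addSn -addnS.
Qed.

Lemma Xop_fop h i y : Xop h (f i y) = f i (Xop h y) + h i *: f i y + a i y.
Proof.
rewrite /Xop wop_fop linearD linear_sum /= -!addrA; congr (_ + _).
under eq_bigr => k _ do rewrite eop_fop.
rewrite big_split /= addrCA; congr (_ + (_ + _)).
rewrite (bigD1 i) //= eqxx scale1r big1 ?addr0 // => k /negbTE ->.
by rewrite scale0r.
Qed.

Lemma Xop_iter_fop h i y m :
  Xop h (iter m.+1 (f i) y) = iter m.+1 (f i) (Xop h y)
    + (m.+1%:R * h i) *: iter m.+1 (f i) y
    + m.+1%:R *: (iter m (f i) (a i y) - m%:R *: iter m (f i) y).
Proof.
elim: m => [|m IH]; first by rewrite /= Xop_fop mul1r !scale1r scale0r subr0.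
rewrite iterS Xop_fop IH (sl2_a_iterf (sl2_af lam Cdiag i)).
rewrite !linearD !linearZ /= ?linearN ?linearZ /=.
by apply/fspaceP => b; rewrite !fspE -!natr1; ring.
Qed.

Lemma Xop_srefl h i y :
  Xop (srefl_h i h) y = Xop h y + h i *: a i y - ((lam i)%:~R * h i) *: y.
Proof.
apply/fspaceP => b; rewrite !fspE !XopE /aop /wop /hw /srefl_h.
by rewrite sumrB sumrN -mulr_suml; ring.
Qed.

(* With [h' = s_i h], the operator [exp (h_i f_i)] conjugates [Xop h] into
   [Xop h' + lam_i h_i]. *)
Lemma exp_eig h i y c M :
  Xop (srefl_h i h) y = c *: y ->
  iter M (f i) y = 0 -> iter M (f i) (a i y) = 0 ->
  [pchar K] =i pred0 ->
  let z := \sum_(k < M.+1) (h i ^+ k / (k`!)%:R) *: iter k (f i) y in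
  Xop h z = (c + (lam i)%:~R * h i) *: z.
Proof.
move=> hX fM fMa charK /=; set c' := c + _.
have hX' : Xop h y = c' *: y - h i *: a i y.
  rewrite /c' scalerDl -hX Xop_srefl; apply/fspaceP => b; rewrite !fspE; ring.
pose Q k := iter k (f i) (a i y) - k%:R *: iter k (f i) y.
have XS k : Xop h (iter k.+1 (f i) y) =
    c' *: iter k.+1 (f i) y - h i *: Q k.+1 + k.+1%:R *: Q k.
  rewrite Xop_iter_fop hX' iter_linearD -scaleNr !iter_linearZ /Q.
  by apply/fspaceP => b; rewrite !fspE; ring.
(* The terms in [Q] telescope over [k], leaving one boundary term, which vanishes by nilpotency. *)
suff -> : Xop h (\sum_(k < M.+1) (h i ^+ k / (k`!)%:R) *: iter k (f i) y) =
    c' *: (\sum_(k < M.+1) (h i ^+ k / (k`!)%:R) *: iter k (f i) y)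
    - (h i ^+ M.+1 / (M`!)%:R) *: Q M.
  by rewrite /Q fM fMa scaler0 subr0 scaler0 subr0.
elim: M {fM fMa} => [|M IH].
  rewrite !big_ord_recl !big_ord0 !addr0 /= expr0 expr1 fact0 divr1 !scale1r.
  by rewrite hX' /Q scale0r subr0 divr1.
have XD (u w : V) b : Xop h (u + b *: w) = Xop h u + b *: Xop h w.
  by rewrite linearD linearZ.
rewrite big_ord_recr XD IH (XS M) /=; clearbody Q.
have -> : h i ^+ M.+1 / (M`!)%:R = h i ^+ M.+1 / (M.+1`!)%:R * M.+1%:R.
  have M0 : M.+1%:R != 0 :> K by have /pcharf0P -> := charK.
  by rewrite factS natrM invfM mulrA mulrAC divfK.
rewrite scalerDr; apply/fspaceP => b; rewrite !fspE !exprS -!natr1; ring.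
Qed.

(** Both [exp (h_i f_i) y] and [h_i^m y1] are finitely supported eigenvectors of [Xop h] with the
    same eigenvalue and the same component of content [d1]. They are equal by [eig_unique], and the
    claim is this equality at the empty word. *)
Lemma wsum_refl h i d n m v : generic h -> hom d v -> ht d = n%:Z ->
  wt d i = m%:Z -> nilf C lam i v -> e i v = 0 ->
  wsum h (n + m) ((m`!)%:R^-1 *: iter m (f i) v) * h i ^+ m =
    wsum (srefl_h i h) n v.
Proof.
move=> gh hv hd wd nv ev; set v1 := _ *: iter _ _ _.
have charK := generic_char0 gh.
pose d1 := d + simple_root i *+ m.
have hv1 : hom d1 v1 by apply/hom_scale/hom_iter_fop.
have hd1 : ht d1 = (n + m)%:Z by rewrite PoszD -hd /d1 pmulrn ht_addMz.
have gh' := generic_srefl i gh.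
pose y := Gser (srefl_h i h) n v; pose y1 := Gser h (n + m) v1.
have [M0 hM0] : nilf C lam i y by apply: nilf_Gser.
(* Large enough for [f_i^M] to kill [y] and for the term [k = m] to occur in the exponential sum. *)
pose M := maxn M0 m.
have fM : iter M (f i) y = 0 by apply: iter_eq0_leq hM0; apply: leq_maxl.
have fMa : iter M (f i) (a i y) = 0.
  by rewrite aop_iter // fM linear0 scaler0 addr0.
have hX : Xop (srefl_h i h) y = hlin (srefl_h i h) d *: y by apply: Gser_eig.
have := exp_eig hX fM fMa charK; set z := \sum_(k < M.+1) _.
have -> : hlin (srefl_h i h) d + (lam i)%:~R * h i = hlin h d1.
  rewrite hlin_srefl srefl_rE /d1 pmulrn -wd /wt !hlinD hlinN !hlinMz.
  by rewrite hlin_simple_root rmorphB; ring.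
move=> /= hz.
have by_ : bounded y by apply/bounded_Gser/(bounded_hom hv hd).
have bz : bounded z.
  apply: bounded_sum => k _; apply: bounded_scale.
  by elim: (nat_of_ord k) => //= j; apply: bounded_fop.
have z_eq : z - h i ^+ m *: y1 = 0.
  apply: (@eig_unique h d1) => //.
  - rewrite -scaleNr; apply: bounded_add => //; apply: bounded_scale.
    exact/bounded_Gser/(bounded_hom hv1 hd1).
  - by rewrite linearB linearZ /= hz (Gser_eig gh hv1 hd1) scalerBr !scalerA mulrC.
  move=> b hb; rewrite !fspE /z fsumE.
  have -> : y1 b = v1 b.
    apply: Gser_base => -[//|k w] _; apply/eqP; apply/negPn/negP => /hv1.
    rewrite cont_cat hb -[RHS]add0r => /addIr/ffunP/(_ k)/eqP.
    by rewrite ffunE gt_eqF ?cont_cons_gt0.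
  (* In content [d1] only [k = m] contributes. A nonempty word in the series for [y] would have to
     consist of letters [i], and those are excluded by [e_i v = 0]. *)
  have fy k : iter k (f i) y b = ((k == m)%:R *: iter m (f i) v) b.
    have -> : (k == m)%:R *: iter m (f i) v = iter k (f i) ((k == m)%:R *: v).
      by rewrite iter_linearZ; case: eqP => [->//|_]; rewrite !scale0r.
    apply: (@iter_fop_local _ _ _ _ k (d1 - simple_root i *+ k)); last by rewrite subrK.
    move=> b' hb'; rewrite fspE /y Gser_base => [|[//|j w] _].
      have [_|nkm] := eqVneq k m; first by rewrite mul1r.
      rewrite mul0r; apply/eqP; apply/negPn/negP => /hv.
      rewrite hb' /d1 -addrA -[RHS]addr0 => /addrI/ffunP/(_ i)/eqP.
      rewrite !ffunE !ffunMnE !ffunE eqxx subr_eq0 !natz.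
      by rewrite eqz_nat eq_sym (negbTE nkm).
    have [->|nj] := eqVneq j i; first by rewrite -[LHS]/(e i v (w ++ b')) ev.
    apply/eqP; apply/negPn/negP => /hv; rewrite cont_cat hb' /d1.
    rewrite addrC -!addrA -[RHS]addr0 => /addrI/ffunP/(_ j)/eqP.
    rewrite !ffunE !ffunMnE !ffunE (negbTE nj) !mul0rn oppr0 !add0r.
    by rewrite gt_eqF ?cont_cons_gt0.
  have mM : (m < M.+1)%N by rewrite ltnS leq_maxr.
  rewrite (bigD1 (Ordinal mM)) //= big1 => [|k /negbTE nk].
    by rewrite fspE fy fspE eqxx addr0 /v1 fspE mul1r mulrA subrr.
  by rewrite fspE fy fspE (_ : (k == m :> nat) = false) ?mul0r ?mulr0 // -nk.
(* Images of [f_i] vanish at the empty word, so only the term [k = 0] of [z] survives. *)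
move/(congr1 (fun z : V => z [::])): z_eq; rewrite !fspE.
rewrite /y1 (Gser_nil h hv1 hd1) -(Gser_nil (srefl_h i h) hv hd) -/y => /eqP.
rewrite subr_eq0 mulrC => /eqP <-; rewrite /z fsumE big_ord_recl big1 => [|k _].
  by rewrite addr0 fspE expr0 fact0 divr1 mul1r.
by rewrite fspE lift0 iterS fop_nil mulr0.
Qed.

End Eigenvector.

(** * Product formula over inversions and the Shapovalov form *)

Section ProductFormula.
Variables (r : nat) (C : 'I_r.+1 -> 'I_r.+1 -> int) (K : fieldType).
Local Notation I := 'I_r.+1.
Hypothesis Cdiag : forall i, C i i = 2.
Hypothesis Csym : forall i j, C i j = C j i.
Hypothesis Coff : forall i j, i != j -> C i j = 0 \/ C i j = -1.

(* The inversions [beta_k] of [u], each with the exponent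
   [- <mu, u^-1 beta_k^vee>]. *)
Fixpoint inversions (u : seq I) (mu : weight r) : seq (rootv r * int) :=
  if u is i :: u' then
    (simple_root i, wact C u' mu i) ::
      [seq (srefl_r C i p.1, p.2) | p <- inversions u' mu]
  else [::].

Definition Fprod (h : I -> K) (u : seq I) (mu : weight r) : K :=
  \prod_(p <- inversions u mu) hlin h p.1 ^ p.2.

Lemma Fprod_cons h i u mu :
  Fprod h (i :: u) mu = h i ^ wact C u mu i * Fprod (srefl_h C i h) u mu.
Proof.
rewrite /Fprod big_cons hlin_simple_root big_map; congr (_ * _).
by apply: eq_bigr => p _; rewrite hlin_srefl.
Qed.

Lemma Fprod_rcons h i u mu :
  Fprod h (rcons u i) mu =
    Fprod h u (srefl_w C i mu) * hlin h (ract C u (simple_root i)) ^ mu i.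
Proof.
elim: u h => [|k u IH] h.
  by rewrite /Fprod /= !big_seq1 big_nil mul1r.
rewrite rcons_cons !Fprod_cons IH mulrA hlin_srefl.
by rewrite {1}/wact foldr_rcons.
Qed.

Lemma wactD u (mu nu : weight r) : wact C u (mu + nu) = wact C u mu + wact C u nu.
Proof.
elim: u => //= i u ->; apply/ffunP => k; rewrite !ffunE; ring.
Qed.

Lemma FprodD h u mu nu : generic h ->
  Fprod h u (mu + nu) = Fprod h u mu * Fprod h u nu.
Proof.
elim: u h => [|i u IH] h gh; first by rewrite /Fprod big_nil mulr1.
rewrite !Fprod_cons IH; last exact: generic_srefl.
by rewrite wactD ffunE expfzDr ?generic_neq0 // mulrACA.
Qed.

Lemma Fprod_neq0 h u mu : generic h -> Fprod h u mu != 0.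
Proof.
elim: u h => [|i u IH] h gh; first by rewrite /Fprod big_nil oner_neq0.
rewrite Fprod_cons mulf_neq0 ?expfz_neq0 ?generic_neq0 //.
by apply: IH; apply: generic_srefl.
Qed.

Variable lam : weight r.
Hypothesis lam_ge0 : forall i, 0 <= lam i.
Local Notation f := (@fop r C lam K).
Local Notation v0 := (@vlam r K).

Lemma fdata_wact u : (fdata C u lam).2 = wact C u lam.
Proof. by elim: u => //= i u <-; case: (fdata C u lam) => [[fs d] mu]. Qed.

Lemma fdata_cons i u (m := `|wact C u lam i|%N) :
  (fdata C (i :: u) lam).1 =
    (nseq m i ++ (fdata C u lam).1.1, (m`! * (fdata C u lam).1.2)%N).
Proof. by rewrite /m -fdata_wact /=; case: (fdata C u lam) => [[fs d] mu]. Qed.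

Lemma minor_deg_cons i u :
  minor_deg C (i :: u) lam = (minor_deg C u lam + `|wact C u lam i|)%N.
Proof. by rewrite /minor_deg fdata_cons size_cat size_nseq addnC. Qed.

Lemma ht_dvec u : left_reduced C u -> ht (dvec C lam u) = (minor_deg C u lam)%:Z.
Proof.
elim: u => [|i u IH]; first by rewrite /ht big1 // => k _; rewrite ffunE.
case=> hi /IH hu; rewrite minor_deg_cons PoszD -hu gez0_abs ?left_reduced_ge0 //.
by rewrite /= /refl_d wt_dvec ht_addMz.
Qed.

(** Each letter [i] contributes one application of [wsum_refl], and [Fprod_cons] is the same
    recursion, with [h] replaced by [s_i h]. *)
Lemma wsum_vec h u : generic h -> left_reduced C u ->
  wsum h (minor_deg C u lam) (vec C lam K u) * Fprod h u lam = 1.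
Proof.
elim: u h => [|i u IH] h gh.
  move=> _; rewrite /wsum (sum_tuple0 (fun w => Dwd h w * v0 w)).
  by rewrite /Dwd big_ord0 /Fprod big_nil invr1 !mulr1.
move=> red; have [hi ru] := red; have charK := generic_char0 gh.
have [hv nv] := vec_hom_nilf K Cdiag Csym Coff lam_ge0 ru.
have wm : wact C u lam i = `|wact C u lam i|%N by rewrite gez0_abs ?left_reduced_ge0.
have ev := eop_vec Cdiag Csym Coff charK lam_ge0 red.
have wt_m : wt C lam (dvec C lam u) i = `|wact C u lam i|%N by rewrite wt_dvec.
have E := wsum_refl Cdiag gh hv (ht_dvec ru) wt_m (nv i) ev.
rewrite Fprod_cons minor_deg_cons {2}wm -exprnP mulrA E IH //.
exact: generic_srefl.
Qed.

Lemma vec_fdata u b :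
  vec C lam K u b = ((fdata C u lam).1.2)%:R^-1 * foldr f v0 (fdata C u lam).1.1 b.
Proof.
elim: u b => [|i u IH] b; first by rewrite invr1 mul1r.
have -> : vec C lam K (i :: u) b = (`|wact C u lam i|`!)%:R^-1 *
  iter `|wact C u lam i|%N (f i) (vec C lam K u) b by [].
rewrite fdata_cons natrM invfM -mulrA; congr (_ * _).
have -> : vec C lam K u =
    ((fdata C u lam).1.2)%:R^-1 *: foldr f v0 (fdata C u lam).1.1.
  by apply/fspaceP => b'; rewrite IH.
rewrite iter_linearZ fspE foldr_cat; congr (_ * _ b).
by elim: (absz _) => //= k ->.
Qed.

Lemma foldr_f_linear c x y p :
  foldr f (x + c *: y) p = foldr f x p + c *: foldr f y p.
Proof. by elim: p => //= i p ->; rewrite linearD linearZ. Qed.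

Lemma hom_foldr s : hom (cont s) (foldr f v0 s).
Proof.
elim: s => [|k s IH]; first by rewrite /cont big_nil; apply: hom_vlam.
by rewrite cont_cons addrC; apply: hom_fop.
Qed.

(** A named copy of the inner fixpoint of [shap], so that it can be reasoned about separately. *)
Definition shap_step (S : seq I -> int) (i : I) :=
  fix go (p s : seq I) {struct s} : int :=
    match s with
    | [::] => 0
    | k :: s' =>
        (if k == i then (lam i - \sum_(q <- s') C q i) * S (p ++ s') else 0)
        + go (rcons p k) s'
    end.

Lemma shap_step_cons S i p k s : shap_step S i p (k :: s) =
  (if k == i then (lam i - \sum_(q <- s) C q i) * S (p ++ s) else 0)
  + shap_step S i (rcons p k) s.
Proof. by []. Qed.

Lemma shap_foldr b s : (shap C lam b s)%:~R = foldr f v0 s b.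
Proof.
elim: b s => [|i b IH] s; first by case: s.
rewrite -[shap _ _ _ _]/(shap_step (shap C lam b) i [::] s).
(* Invariant for the accumulator [p]: [e_i] has already been moved past the letters of [p] and still
   has to pass those of [s]. *)
rewrite -[RHS]/(foldr f (eop i (foldr f v0 s)) [::] b).
elim: s [::] => [|k s IHs] p.
  rewrite [foldr _ _ [::]]/= eop_vlam.
  have -> : foldr f 0 p = 0 by elim: p => //= j p ->; rewrite linear0.
  by [].
rewrite shap_step_cons rmorphD /= IHs foldr_rcons eop_fop.
rewrite foldr_f_linear faddE addrC; congr (_ + _).
rewrite fscaleE eq_sym; case: eqP => [->|_]; last by rewrite mul0r.
rewrite mul1r rmorphM /= IH foldr_cat (hom_aop C lam k (@hom_foldr s)).
rewrite -[_ *: _]add0r foldr_f_linear faddE fscaleE.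
have -> : foldr f 0 p = 0 by elim: p => //= j p ->; rewrite linear0.
by rewrite add0r /wt sum_cont.
Qed.

End ProductFormula.

(** * Specialization to the indeterminates *)

Section Dbar.
Variables (r : nat) (C : 'I_r.+1 -> 'I_r.+1 -> int).
Local Notation I := 'I_r.+1.
Local Notation K := (ratfun r).
Hypothesis Cdiag : forall i, C i i = 2.
Hypothesis Csym : forall i j, C i j = C j i.
Hypothesis Coff : forall i j, i != j -> C i j = 0 \/ C i j = -1.

Lemma constK_intr (z : int) : constK r z%:~R = z%:~R.
Proof. by rewrite /constK !rmorph_int. Qed.

Lemma constK_frac (z : int) (d : nat) :
  constK r (z%:~R / d%:R) = d%:R^-1 * z%:~R.
Proof.
have [->|d0] := eqVneq d 0%N.
  by rewrite invr0 mulr0 /constK mpolyC0 rmorph0 invr0 mul0r.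
have dK : d%:R != 0 :> K.
  by rewrite -[d%:R](constK_intr d) /constK tofrac_eq0 mpolyC_eq0 pnatr_eq0.
apply: (mulfI dK); rewrite mulVKf // -[d%:R](constK_intr d) /constK.
rewrite -rmorphM -mpolyCM mulrC divfK ?pnatr_eq0 //; exact: constK_intr.
Qed.

Lemma generic_alpha : generic (@alpha r).
Proof.
move=> b; apply: contraNneq => hb; apply/eqP/ffunP => k; rewrite [RHS]ffunE.
have : tofrac (\sum_i (b i)%:~R * 'X_i : {mpoly algC[r.+1]}) = 0.
  rewrite -hb rmorph_sum; apply: eq_bigr => i _.
  by rewrite rmorphM rmorph_int.
move/eqP; rewrite tofrac_eq0 => /eqP/(congr1 (mcoeff U_(k)))/eqP.
rewrite mcoeff0 raddf_sum /= (bigD1 k) //= big1 => [|i /negbTE ik].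
  rewrite mulrzl -[_ *~ _]scaler_int mcoeffZ mcoeffX eqxx mulr1 addr0.
  by rewrite intr_eq0 => /eqP.
by rewrite mulrzl -scaler_int mcoeffZ mcoeffX eq_mnm1 ik mulr0.
Qed.

Lemma Dbar_minor (u : seq I) (lam : weight r) : (forall i, 0 <= lam i) ->
  left_reduced C u ->
  Dbar (minor_pair C u lam) (minor_deg C u lam) = (Fprod C (@alpha r) u lam)^-1.
Proof.
move=> lam0 ru.
have E := wsum_vec Cdiag Csym Coff lam0 generic_alpha ru.
have F0 := Fprod_neq0 Cdiag u lam generic_alpha.
apply: (mulIf F0); rewrite mulVf // -E; congr (_ * _).
(* [Dword] is convertible to [Dwd] at the point [alpha], so only the pairings remain to be
   compared. *)
apply: eq_bigr => w _; congr (_ * _).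
by rewrite vec_fdata -shap_foldr /minor_pair constK_frac.
Qed.

End Dbar.

(** * Positivity of roots along reduced words *)

Section Positivity.
Variables (r : nat) (C : 'I_r.+1 -> 'I_r.+1 -> int).
Local Notation I := 'I_r.+1.
Hypothesis Cdiag : forall i, C i i = 2.
Hypothesis Csym : forall i j, C i j = C j i.
Hypothesis Coff : forall i j, i != j -> C i j = 0 \/ C i j = -1.

Definition to_weight (b : rootv r) : weight r := [ffun k => \sum_(q : I) b q * C q k].

Definition qform (b : rootv r) : int := \sum_k to_weight b k * b k.

Hypothesis qform_ge2 : forall b, b != 0 -> 2 <= qform b.

Lemma to_weight_srefl i b : to_weight (srefl_r C i b) = srefl_w C i (to_weight b).
Proof.
apply/ffunP => k; rewrite srefl_rE !ffunE.
under eq_bigr => q _ do rewrite !ffunE ffunMzE mulrBl.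
rewrite sumrB -(sum_simple_root i (fun q => (\sum_(q0 : I) b q0 * C q0 i) * C q k)).
congr (_ - _); apply: eq_bigr => q _.
by rewrite -mulrzr intz mulrA.
Qed.

Lemma qform_ract u b : qform (ract C u b) = qform b.
Proof.
elim: u => //= i u <-.
by rewrite /qform to_weight_srefl pair_srefl // srefl_rK.
Qed.

Lemma qform_simple_root i : qform (simple_root i) = 2.
Proof.
rewrite /qform; under eq_bigr => k _ do rewrite mulrC.
by rewrite sum_simple_root ffunE sum_simple_root.
Qed.

(** Write [b = p - m] with disjoint supports. Off-diagonal Cartan entries are nonpositive, so
    [(p, m) <= 0]; if [p] and [m] were both nonzero, then [(b, b) >= 2 + 2]. *)
Lemma root_sign_coherent b : qform b = 2 ->
  (forall k, 0 <= b k) \/ (forall k, b k <= 0).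
Proof.
move=> qb.
pose p : rootv r := [ffun k => Num.max (b k) 0].
pose m : rootv r := [ffun k => Num.max (- b k) 0].
have bE k : b k = p k - m k by rewrite !ffunE; lia.
have pm_le0 : \sum_k to_weight p k * m k <= 0.
  rewrite -oppr_ge0 -sumrN; apply: sumr_ge0 => k _; rewrite ffunE.
  rewrite mulr_suml -sumrN; apply: sumr_ge0 => q _; rewrite !ffunE.
  have [->|/Coff] := eqVneq q k.
    have [h|h] := lerP (b k) 0; first by rewrite !mul0r oppr0.
    by rewrite (_ : Num.max (- b k) 0 = 0) ?mulr0 ?oppr0 //; lia.
  set x := Num.max (b q) 0; set y := Num.max (- b k) 0.
  have x0 : 0 <= x by rewrite le_max lexx orbT.
  have y0 : 0 <= y by rewrite le_max lexx orbT.
  by case=> ->; rewrite ?mulr0 ?mul0r ?oppr0 // mulrN1 mulNr opprK mulr_ge0.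
have sym : \sum_k to_weight m k * p k = \sum_k to_weight p k * m k.
  under eq_bigr => k _ do rewrite [to_weight m k]ffunE mulr_suml.
  rewrite exchange_big; apply: eq_bigr => k _; rewrite [to_weight p k]ffunE mulr_suml.
  by apply: eq_bigr => q _; rewrite (Csym k q); ring.
have qE : qform b = qform p + qform m - 2 * (\sum_k to_weight p k * m k).
  rewrite [2 * _]mulrC mulrDr mulr1 -{1}sym /qform -!big_split -sumrB /=.
  apply: eq_bigr => k _.
  have -> : to_weight b k = to_weight p k - to_weight m k.
    rewrite !ffunE -sumrB; apply: eq_bigr => q _; rewrite -mulrBl -bE.
    by [].
  rewrite bE; ring.
have [p0|/qform_ge2 hp] := eqVneq p 0.
  right=> k; rewrite bE p0 ffunE sub0r oppr_le0 ffunE le_max lexx orbT //.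
have [m0|/qform_ge2 hm] := eqVneq m 0.
  by left=> k; rewrite bE m0 [(0 : rootv r) k]ffunE subr0 ffunE le_max lexx orbT.
exfalso; lia.
Qed.

(** Only the coordinate [i] changes. If [s_i b] were negative, all other coordinates of [b] would be
    0, and [2 = 2 b_i^2] would force [b = alpha_i]. *)
Lemma srefl_pos_root i b : qform b = 2 -> (forall k, 0 <= b k) ->
  b <> simple_root i -> forall k, 0 <= srefl_r C i b k.
Proof.
move=> qb b0 bi.
have [//|neg] : (forall k, 0 <= srefl_r C i b k) \/ (forall k, srefl_r C i b k <= 0).
  by apply: root_sign_coherent; rewrite (qform_ract [:: i]).
case: bi; have bE : b = simple_root i *~ b i.
  apply/ffunP => k; rewrite ffunMzE ffunE.
  case: eqP => [->|/eqP ki]; first by rewrite intz.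
  apply/eqP; rewrite mul0rz eq_le b0 andbT.
  by have := neg k; rewrite ffunE (negbTE ki).
have : qform b = 2 * (b i * b i).
  rewrite -(qform_simple_root i) {1}bE /qform mulr_suml; apply: eq_bigr => k _.
  have -> : to_weight (simple_root i *~ b i) k = b i * to_weight (simple_root i) k.
    rewrite !ffunE mulr_sumr; apply: eq_bigr => q _.
    by rewrite ffunMzE -mulrzr intz; ring.
  by rewrite ffunMzE -mulrzr intz; ring.
rewrite qb => h; have bi1 : b i = 1 by have := b0 i; nia.
by rewrite bE bi1.
Qed.

Lemma srefl_wK i : involutive (srefl_w C i).
Proof. by move=> mu; apply/ffunP => k; rewrite !ffunE Cdiag; ring. Qed.

Lemma wact_cat u v mu : wact C (u ++ v) mu = wact C u (wact C v mu).
Proof. exact: foldr_cat. Qed.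

Lemma wact_rev u mu : wact C (rev u) (wact C u mu) = mu.
Proof.
elim: u mu => //= i u IH mu.
by rewrite rev_cons -cats1 wact_cat /= srefl_wK IH.
Qed.

(** This is [u s_j u^-1 = s_{u alpha_j}], rewritten as [s_p u s_j = u]. *)
Lemma wact_conj u j p : ract C u (simple_root j) = simple_root p ->
  wequiv C (p :: u ++ [:: j]) u.
Proof.
move=> up mu; rewrite /= wact_cat /=.
suff -> : wact C u (srefl_w C j mu) = srefl_w C p (wact C u mu) by rewrite srefl_wK.
have h v : wact C v (srefl_w C j mu) =
    wact C v mu - to_weight (ract C v (simple_root j)) *~ mu j.
  elim: v => [|i v IH]; last first.
    rewrite /= IH to_weight_srefl; apply/ffunP => k.
    rewrite !ffunE !ffunMzE !ffunE !mulrzz; ring.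
  apply/ffunP => k; rewrite !ffunE ffunMzE ffunE sum_simple_root -mulrzr intz.
  by rewrite mulrC.
have mu_p : wact C u mu p = mu j.
  rewrite wact_simple // -up -{2}[u]revK ract_rev //.
  under eq_bigr => q _ do rewrite mulrC.
  exact: sum_simple_root.
rewrite h up; apply/ffunP => k.
by rewrite !ffunE ffunMzE ffunE sum_simple_root mulrzz mu_p mulrC.
Qed.

Definition reduced (w : seq I) := forall v, wequiv C v w -> (size w <= size v)%N.

(** Adding letters on the left of [u] keeps the root positive until it equals the next simple root
    [alpha_p]; there [s_p u s_j = u] would shorten the word by two letters. *)
Lemma reduced_pos u x j z : reduced (x ++ u ++ j :: z) ->
  forall k, 0 <= ract C u (simple_root j) k.
Proof.
elim: u x => [|p u IH] x red; first by move=> k; rewrite ffunE.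
have pos := IH (rcons x p); rewrite cat_rcons in pos; have {}pos := pos red.
have [up|up] := eqVneq (ract C u (simple_root j)) (simple_root p); last first.
  by apply: srefl_pos_root pos (elimN eqP up); rewrite qform_ract qform_simple_root.
have /red : wequiv C (x ++ u ++ z) (x ++ (p :: u) ++ j :: z).
  have E nu : wact C (p :: u) (wact C [:: j] nu) = wact C u nu.
    by rewrite -wact_cat; apply: wact_conj up nu.
  by move=> mu; rewrite -[j :: z]cat1s !wact_cat E.
by rewrite !size_cat /= => h; exfalso; lia.
Qed.

Lemma reduced_rev w : reduced w -> reduced (rev w).
Proof.
move=> red v hv; rewrite size_rev -(size_rev v); apply: red => mu.
by rewrite -{1}(wact_rev w mu) -hv wact_rev.
Qed.

Lemma reduced_left u x y : reduced (x ++ u ++ y) -> left_reduced C u.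
Proof.
elim: u x => //= i u IH x red; split; last by apply: (IH (rcons x i)); rewrite cat_rcons.
apply: (@reduced_pos (rev u) (rev y) i (rev x)).
have := reduced_rev red; rewrite !rev_cat rev_cons -!cats1 rev_cat /=.
by rewrite -!catA.
Qed.

End Positivity.

(** * Positive definiteness of the Cartan forms of types A and D4 *)

Lemma qform_cartan_A (c : nat -> int) n
    (Q := fun m => \sum_(i < m) \sum_(j < m) c i * c j * cartan_A i j) :
  (exists i, (i <= n)%N && (c i != 0)) -> 2 <= Q n.+1.
Proof.
have Qrec m : Q m.+2 = Q m.+1 + 2 * c m.+1 ^+ 2 - 2 * (c m * c m.+1).
  have col : \sum_(i < m.+1) c i * c m.+1 * cartan_A i m.+1 = - (c m * c m.+1).
    rewrite big_ord_recr big1 => [|i _].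
      by rewrite /cartan_A /= ltn_eqF // eqxx orbT mulrN1 add0r.
    have him := ltn_ord i; rewrite /cartan_A /=.
    have h1 : (nat_of_ord i == m.+1) = false by apply: ltn_eqF; lia.
    have h2 : (nat_of_ord i == m.+2) = false by apply: ltn_eqF; lia.
    have h3 : (m.+1 == i.+1) = false by apply: gtn_eqF; lia.
    by rewrite h1 h2 h3 mulr0.
  rewrite /Q [LHS]big_ord_recr [X in _ + X = _]big_ord_recr /=.
  under eq_bigr => i _ do rewrite big_ord_recr /=.
  rewrite big_split /= col.
  rewrite [X in _ + (X + _) = _](eq_bigr
    (fun i : 'I_m.+1 => c i * c m.+1 * cartan_A i m.+1)); last first.
    by move=> i _; rewrite /cartan_A eq_sym orbC [c m.+1 * _]mulrC.
  by rewrite col /cartan_A eqxx; ring.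
have Q1 : Q 1%N = 2 * c 0%N ^+ 2 by rewrite /Q !big_ord1 /cartan_A eqxx; ring.
have even m : exists t, Q m.+1 = 2 * t.
  elim: m => [|m [t ht]]; first by exists (c 0%N ^+ 2).
  by exists (t + c m.+1 ^+ 2 - c m * c m.+1); rewrite Qrec ht; ring.
(* Underlying identity: [Q (m+1) = c_0^2 + sum_i (c_i - c_(i+1))^2 + c_m^2]. The last square is
   split off so that the induction adds one difference at a time. *)
have pos m : 0 <= Q m.+1 - c m ^+ 2 /\
    (Q m.+1 - c m ^+ 2 <= 0 -> c m = 0 -> forall i, (i <= m)%N -> c i = 0).
  elim: m => [|m [IH1 IH2]].
    split; first by rewrite Q1; have := sqr_ge0 (c 0%N); lia.
    by move=> _ h i; rewrite leqn0 => /eqP ->.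
  have E : Q m.+2 - c m.+1 ^+ 2 = (Q m.+1 - c m ^+ 2) + (c m - c m.+1) ^+ 2.
    by rewrite Qrec; ring.
  rewrite E; have s0 := sqr_ge0 (c m - c m.+1); split; first by rewrite addr_ge0.
  move=> h cm; have d0 : (c m - c m.+1) ^+ 2 = 0 by lia.
  have cm0 : c m = 0 by move/eqP: d0; rewrite sqrf_eq0 cm subr0 => /eqP.
  move=> i; rewrite leq_eqVlt => /orP[/eqP -> //|].
  by rewrite ltnS; apply: IH2 => //; lia.
case=> i /andP[hi ci]; have [t ht] := even n; have [h1 h2] := pos n.
rewrite ht; suff : ~ (Q n.+1 <= 0) by lia.
move=> h; have sn := sqr_ge0 (c n).
have cn : c n ^+ 2 = 0 by lia.
move/eqP: ci; apply; apply: h2 => //; first lia.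
by move/eqP: cn; rewrite sqrf_eq0 => /eqP.
Qed.

Lemma typeA_or_D4_cartan r (C : 'I_r.+1 -> 'I_r.+1 -> int) : typeA_or_D4 C ->
  [/\ forall i, C i i = 2, forall i j, C i j = C j i,
      forall i j, i != j -> C i j = 0 \/ C i j = -1
    & forall b, b != 0 -> 2 <= qform C b].
Proof.
case=> [hC|[r3 hC]].
  split=> [i|i j|i j nij|b b0].
  - by rewrite hC /cartan_A eqxx.
  - by rewrite !hC /cartan_A eq_sym orbC.
  - rewrite hC /cartan_A ifF; last exact/negbTE.
    by case: ifP; [right|left].
  pose c (k : nat) : int := b (inord k).
  have -> : qform C b =
      \sum_(i < r.+1) \sum_(j < r.+1) c i * c j * cartan_A i j.
    apply: eq_bigr => i _; rewrite ffunE mulr_suml; apply: eq_bigr => j _.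
    by rewrite /c !inord_val hC /cartan_A eq_sym orbC; ring.
  apply: (@qform_cartan_A c r).
  have [k bk] : exists k, b k != 0.
    apply/existsP; apply: contraR b0; rewrite negb_exists => /forallP h.
    by apply/eqP/ffunP => k; rewrite ffunE; apply/eqP; move: (h k); rewrite negbK.
  by exists k; rewrite /c inord_val bk -ltnS ltn_ord.
subst r; split=> [i|i j|i j nij|b b0].
- by rewrite hC /cartan_D4 eqxx.
- by rewrite !hC /cartan_D4 eq_sym orbC.
- rewrite hC /cartan_D4 ifF; last exact/negbTE.
  by case: ifP; [right|left].
pose c (k : nat) : int := b (inord k).
pose s := c 0%N * c 0%N + c 1%N * c 1%N + c 2%N * c 2%N + c 3%N * c 3%N
  - c 1%N * (c 0%N + c 2%N + c 3%N).
have E : qform C b = 2 * s.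
  have -> : qform C b = \sum_(i < 4) \sum_(j < 4) c i * c j * cartan_D4 i j.
    apply: eq_bigr => i _; rewrite ffunE mulr_suml; apply: eq_bigr => j _.
    by rewrite /c !inord_val hC /cartan_D4 eq_sym orbC; ring.
  by rewrite !big_ord_recl !big_ord0 /= /bump /= ?(addn0, add1n) /cartan_D4 /= /s; ring.
rewrite E; suff : ~ (s <= 0) by lia.
move=> s0; case/negP: b0; apply/eqP/ffunP => k; rewrite [RHS]ffunE.
(* Completing the square at each of the three leaves; vertex 1 is the centre of the diagram. *)
have F : 4 * s = (2 * c 0%N - c 1%N) ^+ 2 + (2 * c 2%N - c 1%N) ^+ 2
  + (2 * c 3%N - c 1%N) ^+ 2 + c 1%N ^+ 2 by rewrite /s; ring.
have h0 := sqr_ge0 (2 * c 0%N - c 1%N); have h2 := sqr_ge0 (2 * c 2%N - c 1%N).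
have h3 := sqr_ge0 (2 * c 3%N - c 1%N); have h1 := sqr_ge0 (c 1%N).
have /eqP : c 1%N ^+ 2 = 0 by lia.
have /eqP : (2 * c 0%N - c 1%N) ^+ 2 = 0 by lia.
have /eqP : (2 * c 2%N - c 1%N) ^+ 2 = 0 by lia.
have /eqP : (2 * c 3%N - c 1%N) ^+ 2 = 0 by lia.
rewrite !sqrf_eq0 => /eqP e3 /eqP e2 /eqP e0 /eqP e1.
rewrite -(inord_val k) -[b _]/(c k).
by case: k => [[|[|[|[|k]]]] hk] //=; lia.
Qed.

(** * Flag minors of a reduced word and their relations *)

Section FlagMinors.
Variables (r : nat) (C : 'I_r.+1 -> 'I_r.+1 -> int).
Local Notation I := 'I_r.+1.
Hypothesis Cdiag : forall i, C i i = 2.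
Hypothesis Csym : forall i j, C i j = C j i.
Hypothesis Coff : forall i j, i != j -> C i j = 0 \/ C i j = -1.
Hypothesis qform_ge2 : forall b, b != 0 -> 2 <= qform C b.
Variable w : seq I.
Hypothesis red : reduced C w.

Lemma omega_ge0 (i k : I) : 0 <= omega i k.
Proof. by rewrite ffunE. Qed.

Lemma inversions_split u (mu : weight r) p : p \in inversions C u mu ->
  exists u1 i u2, [/\ u = u1 ++ i :: u2, p.1 = ract C u1 (simple_root i)
                    & p.2 = wact C u2 mu i].
Proof.
elim: u p => //= i u IH p; rewrite inE => /orP[/eqP -> |/mapP[q /IH]].
  by exists [::], i, u.
case=> u1 [k [u2 [-> q1 q2]]] ->.
by exists (i :: u1), k, u2; rewrite /= q1 q2.
Qed.

Lemma reduced_split j u1 i u2 : take j w = u1 ++ i :: u2 ->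
  w = u1 ++ i :: u2 ++ drop j w.
Proof. by move=> h; rewrite -{1}(cat_take_drop j w) h -catA. Qed.

Lemma left_reduced_take j : left_reduced C (take j w).
Proof.
apply: (@reduced_left r C Cdiag Csym Coff qform_ge2 _ [::] (drop j w)).
by rewrite /= cat_take_drop.
Qed.

Lemma Dbar_flag_Fprod j :
  Dbar_flag C w j = (Fprod C (@alpha r) (take j w) (omega (letter w j)))^-1.
Proof. by apply: Dbar_minor => // [i|]; [apply: omega_ge0 | apply: left_reduced_take]. Qed.

Lemma inversions_pos j (mu : weight r) p : (forall i, 0 <= mu i) ->
  p \in inversions C (take j w) mu -> is_pos_root C p.1 /\ 0 <= p.2.
Proof.
move=> mu0 /inversions_split[u1 [i [u2 [hw -> ->]]]].
have hw' := reduced_split hw; split; first split.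
- by exists u1, i.
- apply: (reduced_pos Cdiag Csym Coff qform_ge2 (x := [::]) (z := u2 ++ drop j w)).
  by rewrite /= -hw'.
apply: left_reduced_ge0 => //.
have : reduced C (u1 ++ (i :: u2) ++ drop j w) by rewrite /= -hw'.
by case/(reduced_left Cdiag Csym Coff qform_ge2).
Qed.

Lemma Dbar_flag_prod j : exists s : seq ({ffun I -> int} * nat),
  (forall p, p \in s -> is_pos_root C p.1) /\
  Dbar_flag C w j = (\prod_(p <- s) lin p.1 ^+ p.2)^-1.
Proof.
pose inv := inversions C (take j w) (omega (letter w j)).
have pos p : p \in inv -> is_pos_root C p.1 /\ 0 <= p.2.
  by apply: inversions_pos => i; apply: omega_ge0.
exists [seq (p.1, `|p.2|%N) | p <- inv]; split=> [p /mapP[q /pos[hq _] ->] //|].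
rewrite Dbar_flag_Fprod big_map; congr (_^-1); apply: eq_big_seq => p /pos[_ p2].
by rewrite -{1}(gez0_abs p2).
Qed.

Lemma Ppoly_Fprod j : (0 < j)%N ->
  Ppoly C w j = Fprod C (@alpha r) (take j w) (omega (letter w j)).
Proof. by case: j => // j _; rewrite /Ppoly Dbar_flag_Fprod invrK. Qed.

Lemma Fprod_take j (mu : weight r) : (0 < j <= size w)%N ->
  Fprod C (@alpha r) (take j w) mu =
    Fprod C (@alpha r) (take j.-1 w) (srefl_w C (letter w j) mu)
    * lin (beta C w j) ^ mu (letter w j).
Proof. by case: j => // j /= hj; rewrite (take_nth ord0) // Fprod_rcons. Qed.

(** Generalizes [jminus] to any letter [k]; the value 0 for a missing letter matches the convention
    [P_0 = 1]. *)
Definition last_occ (j : nat) (k : I) : nat :=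
  \max_(1 <= l < j | letter w l == k) l.

Lemma last_occS j k : (0 < j)%N ->
  last_occ j.+1 k = if letter w j == k then j else last_occ j k.
Proof.
move=> j0; rewrite /last_occ big_mkcond big_nat_recr //= -big_mkcond /=.
case: ifP => _; last by rewrite maxn0.
apply/maxn_idPr; apply/bigmax_leqP_seq => l; rewrite mem_index_iota.
by case/andP=> _ /ltnW.
Qed.

Lemma last_occP j k : (0 < j)%N ->
  (last_occ j k = 0%N /\ forall l, (0 < l < j)%N -> letter w l != k) \/
  [/\ (0 < last_occ j k < j)%N, letter w (last_occ j k) = k &
      forall l, (last_occ j k < l < j)%N -> letter w l != k].
Proof.
elim: j => // -[|j] IH _.
  by left; rewrite /last_occ big_geq; split=> // l; lia.
rewrite last_occS //; case: eqP => [<-|/eqP nk].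
  by right; split=> [||l]; [lia|by []|lia].
case: IH => // [[h0 h]|[h1 h2 h3]]; [left|right]; split=> //.
- move=> l hl; have [->//|nl] := eqVneq l j.+1; apply: h; lia.
- lia.
- move=> l hl; have [->//|nl] := eqVneq l j.+1; apply: h3; lia.
Qed.

(** A reflection [s_i] with [i <> k] fixes [omega k], and its root gets exponent 0; the prefix can
    thus be cut back to the last occurrence of [k]. *)
Lemma Fprod_omega j k : (0 < j <= (size w).+1)%N ->
  Fprod C (@alpha r) (take j.-1 w) (omega k) = Ppoly C w (last_occ j k).
Proof.
elim: j => // -[|j] IH hj.
  by rewrite /last_occ big_geq //= take0 /Fprod big_nil.
rewrite last_occS //; case: eqP => [<-|nk]; first by rewrite -Ppoly_Fprod.
rewrite -IH; last lia.
rewrite [_.+2.-1]/= Fprod_take; last lia.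
have -> : omega k (letter w j.+1) = 0.
  by rewrite ffunE; case: eqP.
rewrite expr0z mulr1; congr (Fprod _ _ _ _); apply/ffunP => l.
rewrite [LHS]ffunE (_ : omega k (letter w j.+1) = 0) ?mul0r ?subr0 //.
by rewrite ffunE; case: eqP.
Qed.

Lemma jplus_gtP j l : (0 < l < j)%N -> (j <= size w)%N ->
  (j < jplus w l)%N <-> (forall m, (l < m <= j)%N -> letter w m != letter w l).
Proof.
move=> hl hj; rewrite /jplus; set fd := find _ _; split=> [hf m hm|h].
  have /(before_find ord0) : (m - l.+1 < fd)%N by lia.
  rewrite nth_drop (_ : l + (m - l.+1) = m.-1)%N /=; last lia.
  by move=> ->.
rewrite ltnNge; apply/negP => hf.
have hfs : (fd < size (drop l w))%N by rewrite size_drop; lia.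
have /(nth_find ord0) : has (pred1 (letter w l)) (drop l w) by rewrite has_find.
rewrite -/fd nth_drop /= => /eqP E.
by have := h (l + fd).+1; rewrite /letter /= E eqxx => /(_ _)/implyP; lia.
Qed.

(** Sort the indices by letter: for a letter [k] adjacent to [i], the condition [l < j < l_+]
    selects the last occurrence of [k] before [j], and a missing letter contributes [F 0 = 1]. *)
Lemma prod_last_occ (R : comNzRingType) (F : nat -> R) j i : (0 < j <= size w)%N ->
  letter w j = i -> F 0%N = 1 ->
  \prod_(1 <= l < j | (j < jplus w l)%N && (C (letter w l) i == -1)) F l =
  \prod_(k | C k i == -1) F (last_occ j k).
Proof.
move=> hj hi F0.
rewrite (partition_big (letter w) (fun k => C k i == -1)) /=; last first.
  by move=> l /andP[].
apply: eq_bigr => k ki.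
have ik : i != k by apply: contraTneq ki => ->; rewrite Cdiag.
have cond l : (0 < l < j)%N ->
    ((j < jplus w l)%N && (C (letter w l) i == -1)) && (letter w l == k) =
    (l == last_occ j k).
  move=> hl; have jw : (j <= size w)%N by case/andP: hj.
  have j0 : (0 < j)%N by case/andP: hj.
  apply/andP/eqP => [[/andP[/(jplus_gtP hl jw) h1 _] /eqP lk]|lE].
    case: (last_occP k j0) => [[_ /(_ l hl)]|[hM Mk h]]; first by rewrite lk eqxx.
    have [lM|Ml|//] := ltngtP l (last_occ j k).
      by have := h1 (last_occ j k); rewrite Mk lk eqxx => /(_ _)/implyP; lia.
    by have := h l; rewrite lk eqxx => /(_ _)/implyP; lia.
  case: (last_occP k j0) => [[M0 _]|[hM Mk h]]; first by move: hl; rewrite lE M0.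
  rewrite lE Mk ki eqxx andbT; split=> //; apply/jplus_gtP => // m hm.
  (* The condition [j < l_+] also concerns position [j] itself, whose letter [i] differs from its
     neighbour [k]. *)
  rewrite Mk; have [->|mj] := eqVneq m j; first by rewrite hi.
  by apply: h; lia.
rewrite big_nat_cond (eq_bigl (fun l => (0 < l < j)%N && (l == last_occ j k))).
  rewrite -(big_nat_cond _ _ 1 j (fun l => l == last_occ j k)) big_nat1_eq.
  case: (@last_occP j k); first by case/andP: hj.
    by case=> -> _.
  by case=> ->.
move=> l /=; case: (boolP (0 < l < j)%N) => //= hl; exact: cond.
Qed.

Lemma srefl_omega i :
  srefl_w C i (omega i) + omega i = \sum_(k | C k i == -1) omega k.
Proof.
apply/ffunP => q; rewrite sum_ffunE !ffunE eqxx mul1r.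
rewrite (eq_bigr (fun k => if k == q then 1 else 0 : int)) => [|k _]; last first.
  by rewrite ffunE eq_sym; case: eqP.
rewrite -big_mkcondr /=.
have [->|qi] := eqVneq q i.
  rewrite Cdiag big_pred0 // => k; have [->|_] := eqVneq k i; last by rewrite andbF.
  by rewrite Cdiag.
have [Cqi|Cqi] := Coff qi; rewrite Csym Cqi /=.
  rewrite big_pred0 // => k; have [->|_] := eqVneq k q; last by rewrite andbF.
  by rewrite Cqi.
rewrite (big_pred1 q) // => k /=; have [->|_] := eqVneq k q; last by rewrite andbF.
by rewrite Cqi.
Qed.

Lemma Fprod_sum (u : seq I) (P : pred I) :
  Fprod C (@alpha r) u (\sum_(k | P k) omega k) =
  \prod_(k | P k) Fprod C (@alpha r) u (omega k).
Proof.
apply: (big_morph (Fprod C (@alpha r) u)) => [mu nu|].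
  by apply: FprodD => //; apply: generic_alpha.
have F0 := Fprod_neq0 Cdiag u (0 : weight r) (@generic_alpha r).
apply: (mulfI F0); rewrite mulr1 -FprodD ?addr0 //; exact: generic_alpha.
Qed.

(** All factors are written over the prefix of length [j-1]: [P_j] gives [s_i omega_i] together with
    the new root [beta_j], and [P_{j_-}] gives [omega_i]. Additivity of the exponents and
    [srefl_omega] then yield the product over the neighbours of [i]. *)
Lemma Ppoly_relation j : (1 <= j <= size w)%N ->
  Ppoly C w j * Ppoly C w (jminus w j) =
    lin (beta C w j) *
    \prod_(1 <= l < j | (j < jplus w l)%N && (C (letter w l) (letter w j) == -1))
      Ppoly C w l.
Proof.
move=> hj; have j0 : (0 < j)%N by case/andP: hj.
rewrite (prod_last_occ hj (erefl (letter w j))) //.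
have om k : Ppoly C w (last_occ j k) = Fprod C (@alpha r) (take j.-1 w) (omega k).
  by rewrite Fprod_omega //; lia.
rewrite -[jminus w j]/(last_occ j (letter w j)) om Ppoly_Fprod // Fprod_take //.
under [in RHS]eq_bigr => k _ do rewrite om.
rewrite -Fprod_sum -srefl_omega FprodD //; last exact: generic_alpha.
by rewrite ffunE eqxx expr1z mulrAC mulrC.
Qed.

End FlagMinors.

(** * Both statements for types A and D4 *)

Theorem theorem1 (r : nat) (C : 'I_r.+1 -> 'I_r.+1 -> int) :
  typeA_or_D4 C ->
  (forall (w : seq 'I_r.+1) (j : nat),
     is_red_w0 C w -> (1 <= j <= size w)%N ->
     exists s : seq ({ffun 'I_r.+1 -> int} * nat),
       (forall p, p \in s -> is_pos_root C p.1) /\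
       Dbar_flag C w j = (\prod_(p <- s) lin p.1 ^+ p.2)^-1)
  /\
  (forall (w : seq 'I_r.+1) (j : nat),
     is_red_w0 C w -> (1 <= j <= size w)%N ->
     Ppoly C w j * Ppoly C w (jminus w j) =
       lin (beta C w j) *
       \prod_(1 <= l < j | (j < jplus w l)%N && (C (letter w l) (letter w j) == -1))
          Ppoly C w l).
Proof.
case/typeA_or_D4_cartan => Cdiag Csym Coff qpos.
split=> w j [red _] hj.
  exact: Dbar_flag_prod.
exact: Ppoly_relation.
Qed.
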